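(* Let $X_Q=V(r^2-qs)\subset\mathbb{C}^4$ and for $d\in\mathbb{N}$ let $g_d:X_Q\to X_Q$ be the Chebyshev-induced morphism on $\mathbb{C}^3/D_4\simeq X_Q$. Let $S_A,S_P,C_1,C_2\subset X_Q$ and $G_A$ be the ($g_d$-invariant) varieties and the map defined in the context. (1) $K(g_d|_{S_A})=\{G_A(2\cos2\alpha,\,2\cos(\alpha+\beta)):0\le\alpha,\beta<2\pi\}$ for $d\ge2$. (2) $S_A\cap S_P=C_1\cup C_2$. (3) $K(g_d|_{S_A})\cap K(g_d|_{S_P})=K(g_d|_{C_1})\cup K(g_d|_{C_2})$ for $d\ge2$. (4) For $d\ge2$, $K(g_d|_{S_A})\cup K(g_d|_{S_P})$ is a real 2-dimensional surface. The surface $K(g_d|_{S_A})\cup K(g_d|_{S_P})$ is invariant under $g_d$ for any $d\in\mathbb{N}$.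
   Context: $\mathbb{N}=\{1,2,\dots\}$. In coordinates $(p,q,r,s)$: $S_P=V(p^2-s,\ qs-r^2)$; $S_A=V(A_h,\ qs-r^2)$ with $A_h=256-192p+48p^2-4p^3-128q-80pq+p^2q+16q^2+288r+36pr-8qr-108s$; $C_1=\{(t^2,\ (2t-2)^2,\ (2t-2)t^2,\ t^4):t\in\mathbb{C}\}$; $C_2=\{(4T,\ (T+2)^2,\ 4T(T+2),\ 16T^2):T\in\mathbb{C}\}$; $G_A(u,v)=(4+2uv+v^2,\ (u+2v)^2,\ (u+2v)(2u+4v+uv^2/2),\ (2u+4v+uv^2/2)^2)$. Definition of $g_d$: the Chebyshev endomorphism $P_{A_3}^d:\mathbb{C}^3\to\mathbb{C}^3$ is defined by $P_{A_3}^d(e_1(t),e_2(t),e_3(t))=(e_1(t^d),e_2(t^d),e_3(t^d))$ for $t=(t_1,t_2,t_3,t_4)\in(\mathbb{C}^* )^4$ with $t_1t_2t_3t_4=1$, where $t^d=(t_1^d,\dots,t_4^d)$ and $e_j$ is the $j$-th elementary symmetric polynomial. With $M_3(x,y,z)=(x+iy,\,z,\,x-iy)$ put $f_d=M_3^{-1}\circ P_{A_3}^d\circ M_3$. $D_4\subset GL(3,\mathbb{R})$ is the dihedral group of order 8 generated by $(x,y,z)\mapsto(-y,x,-z)$ and $(x,y,z)\mapsto(x,-y,z)$. The map $\tilde F(x,y,z)=(x^2+y^2,\,z^2,\,z(x^2-y^2),\,(x^2-y^2)^2)$ from $\mathbb{C}^3$ onto $X_Q$ induces a bijection $\mathbb{C}^3/D_4\simeq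 X_Q$, and $g_d:X_Q\to X_Q$ is the unique map with $g_d\circ\tilde F=\tilde F\circ f_d$ (it is a morphism). For a $g_d$-invariant subvariety $V\subset X_Q$, $K(g_d|_V)$ is the set of $w\in V$ whose forward orbit $\{g_d^k(w):k=1,2,\dots\}$ is bounded in $\mathbb{C}^4$. *)

(* Defs.v *)
From HB Require Import structures.
From mathcomp Require Import all_boot all_order all_algebra.
From mathcomp Require Import all_classical all_reals all_analysis.
From mathcomp Require Import complex.
From mathcomp Require Import ring zify.

Set Implicit Arguments.
Unset Strict Implicit.
Unset Printing Implicit Defensive.

Import Order.TTheory GRing.Theory Num.Theory.
Import numFieldNormedType.Exports.

Local Open Scope classical_set_scope.
Local Open Scope ring_scope.

Notation C3 R := (R[i] * R[i] * R[i])%type.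
Notation C4 R := (R[i] * R[i] * R[i] * R[i])%type.

(* The library puts the topology and the norm of a field on its regular
   module: [C4top R] is [C4 R] with the max norm and the Euclidean topology. *)
Notation C4top R := ((R[i])^o * (R[i])^o * (R[i])^o * (R[i])^o)%type.

Definition elsym (R : realType) (j : nat) (t : 4.-tuple R[i]) : R[i] :=
  \sum_(A : {set 'I_4} | #|A| == j) \prod_(i in A) tnth t i.

Definition elsym3 (R : realType) (t : 4.-tuple R[i]) : C3 R :=
  (elsym 1 t, elsym 2 t, elsym 3 t).

Definition torus (R : realType) : set (4.-tuple R[i]) :=
  [set t | \prod_(i < 4) tnth t i = 1].

Definition tpow (R : realType) (d : nat) (t : 4.-tuple R[i]) : 4.-tuple R[i] :=
  [tuple tnth t i ^+ d | i < 4].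

(* [elsym3] maps [torus R] onto C^3; the value does not depend on the chosen
   preimage, see [chebyshevE]. *)
Definition chebyshev (R : realType) (d : nat) (w : C3 R) : C3 R :=
  elsym3 (tpow d (xget [tuple 1 | i < 4] [set t | torus t /\ elsym3 t = w])).

Definition M3 (R : realType) (v : C3 R) : C3 R :=
  let: (x, y, z) := v in (x + 'i * y, z, x - 'i * y).

Definition M3inv (R : realType) (v : C3 R) : C3 R :=
  let: (a, b, c) := v in ((a + c) / 2, (a - c) / (2 * 'i), b).

Definition f_ (R : realType) (d : nat) (v : C3 R) : C3 R :=
  M3inv (chebyshev d (M3 v)).

Definition Ft (R : realType) (v : C3 R) : C4 R :=
  let: (x, y, z) := v in
  (x ^+ 2 + y ^+ 2, z ^+ 2, z * (x ^+ 2 - y ^+ 2), (x ^+ 2 - y ^+ 2) ^+ 2).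

Definition X_Q (R : realType) : set (C4 R) :=
  [set w | let: (p, q, r, s) := w in r ^+ 2 - q * s = 0].

Arguments X_Q R _ : clear implicits.

(* [g_] is only meaningful on [X_Q R], the image of [Ft] ([Ft_onto]); there it
   does not depend on the chosen preimage, see [g_E]. *)
Definition g_ (R : realType) (d : nat) (w : C4 R) : C4 R :=
  Ft (f_ d (xget (0, 0, 0) [set v | Ft v = w])).

Section WellDefined.
Variable R : realType.
Implicit Types (t s : 4.-tuple R[i]) (v w : C3 R).

Lemma coef_elsym t j : (j <= 4)%N ->
  (\prod_(p <- t) ('X - p%:P))`_(4 - j) = (-1) ^+ j * elsym j t.
Proof.
case/tupleP: t => a t; case/tupleP: t => b t; case/tupleP: t => c t.
case/tupleP: t => e t; rewrite (tuple0 t) => jle.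
rewrite coef_prod_XsubC ?leq_subr //= subKn //; congr (_ * _).
apply: eq_bigr => A _; apply: eq_bigr => i _.
by rewrite (tnth_nth 0).
Qed.

Lemma elsym0 t : elsym 0 t = 1.
Proof.
rewrite /elsym (big_pred1 finset.set0) ?big_set0 // => A.
by rewrite cards_eq0.
Qed.

Lemma elsym4 t : elsym 4 t = \prod_(i < 4) tnth t i.
Proof.
rewrite /elsym (big_pred1 [set: 'I_4]%SET).
  by apply: eq_bigl => i; rewrite finset.in_setT.
by move=> A /=; rewrite [RHS]eqEcard finset.subsetT cardsT card_ord eqn_leq
  andbC (leq_trans (max_card _)) ?card_ord // andbT.
Qed.

Lemma elsym3_inj t s : torus t -> torus s -> elsym3 t = elsym3 s -> perm_eq t s.
Proof.
move=> tt ts [e1 e2 e3]; apply: prod_XsubC_eq; apply/polyP => n.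
have [n4|n4] := ltnP 4 n; first by rewrite !nth_default ?size_prod_XsubC ?size_tuple.
rewrite -(subKn n4) !coef_elsym ?leq_subr //; congr (_ * _).
move: (4 - n)%N (leq_subr n 4) => [|[|[|[|[|//]]]]] _ //.
- by rewrite !elsym0.
- by rewrite !elsym4 tt ts.
Qed.

Lemma elsym_perm j t s : (j <= 4)%N -> perm_eq t s -> elsym j t = elsym j s.
Proof.
move=> j4 ts; apply: (@mulrI _ ((-1) ^+ j)); first by rewrite unitrX ?unitrN1.
by rewrite -!coef_elsym // (perm_big _ ts).
Qed.

Lemma tpow_perm d t s : perm_eq t s -> perm_eq (tpow d t) (tpow d s).
Proof.
have E (u : 4.-tuple R[i]) : tpow d u = map (fun x => x ^+ d) u :> seq _.
  by rewrite /= -[in RHS](map_tnth_enum u) -map_comp.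
by move=> ts; rewrite !E; apply: perm_map.
Qed.

Lemma elsym3_onto w : exists2 t, torus t & elsym3 t = w.
Proof.
case: w => [[a b] c].
pose p : {poly R[i]} := Poly [:: 1; - c; b; - a; 1].
have szp : size p = 5 by rewrite (@PolyK _ 0) //= oner_neq0.
have [r] := closed_field_poly_normal p.
have pE : polyseq p = [:: 1; - c; b; - a; 1] by rewrite (@PolyK _ 0) //= oner_neq0.
have -> : lead_coef p = 1 by rewrite /lead_coef pE.
rewrite scale1r => pr.
have szr : size r == 4 by move: szp; rewrite pr size_prod_XsubC => -[->].
exists (Tuple szr).
  have := @coef_elsym (Tuple szr) 4 isT.
  by rewrite -pr subnn pE elsym4 -signr_odd expr0 mul1r /torus /= => <-.
rewrite /elsym3.
have /= := @coef_elsym (Tuple szr) 1 isT; rewrite -pr pE /= expr1 mulN1r => /oppr_inj <-.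
have /= := @coef_elsym (Tuple szr) 2 isT; rewrite -pr pE /= -signr_odd expr0 mul1r => <-.
by have /= := @coef_elsym (Tuple szr) 3 isT; rewrite -pr pE /= -signr_odd expr1 mulN1r => /oppr_inj <-.
Qed.

Lemma chebyshevE d t : torus t -> chebyshev d (elsym3 t) = elsym3 (tpow d t).
Proof.
move=> tt; rewrite /chebyshev; set s := xget _ _.
have [ts es] : torus s /\ elsym3 s = elsym3 t.
  exact: (@xgetI _ [tuple 1 | i < 4]
           [set t' | torus t' /\ elsym3 t' = elsym3 t] t (conj tt erefl)).
have /(tpow_perm d) p := elsym3_inj ts tt es.
by rewrite /elsym3 !(elsym_perm _ p).
Qed.

Lemma M3K : cancel (@M3 R) (@M3inv R).
Proof.
move=> [[x y] z]; rewrite /M3/M3inv.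
have n2 : (2 : R[i]) != 0 by rewrite pnatr_eq0.
have ni : ('i : R[i]) != 0 by rewrite neq0Ci.
by congr (_, _, _); field; rewrite ?n2 ?ni.
Qed.

Lemma M3invK : cancel (@M3inv R) (@M3 R).
Proof.
move=> [[a b] c]; rewrite /M3/M3inv.
have n2 : (2 : R[i]) != 0 by rewrite pnatr_eq0.
have ni : ('i : R[i]) != 0 by rewrite neq0Ci.
by congr (_, _, _); field; rewrite ?n2 ?ni.
Qed.

(* The maps (x, y, z) |-> (- y, x, - z) and (x, y, z) |-> (x, - y, z), which
   generate the dihedral group D_4. *)
Definition rho4 v : C3 R := let: (x, y, z) := v in (- y, x, - z).
Definition tau4 v : C3 R := let: (x, y, z) := v in (x, - y, z).

Let scale_t (u : R[i]) t : 4.-tuple R[i] := [tuple u * tnth t i | i < 4].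

Lemma elsymZ j u t : elsym j (scale_t u t) = u ^+ j * elsym j t.
Proof.
rewrite /elsym mulr_sumr; apply: eq_bigr => A /eqP cA.
under eq_bigr do rewrite tnth_mktuple.
by rewrite big_split /= prodr_const cA.
Qed.

Let inv_t t : 4.-tuple R[i] := [tuple (tnth t i)^-1 | i < 4].

Lemma torus_neq0 t i : torus t -> tnth t i != 0.
Proof.
move=> tt; apply/eqP => t0; have := oner_neq0 R[i].
by rewrite -tt (bigD1 i) //= t0 mul0r eqxx.
Qed.

Lemma elsymV j t : (j <= 4)%N -> torus t -> elsym j (inv_t t) = elsym (4 - j) t.
Proof.
move=> j4 tt; rewrite /elsym (reindex_inj (inv_inj (@finset.setCK _))) /=.
apply: eq_big => [A|A _].
  have := cardsC A; rewrite card_ord => cA.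
  by apply/eqP/eqP; move: cA; set x := #|A|; set y := #|_|; lia.
have : \prod_(i < 4) tnth t i = 1 by [].
rewrite (bigID (fun i => i \in A)) /= => p1.
under eq_bigr do rewrite tnth_mktuple.
rewrite prodfV; apply: (@mulIf _ (\prod_(i in (~: A)%SET) tnth t i)).
  by apply/prodf_neq0 => i _; apply: torus_neq0.
rewrite mulVf; last by apply/prodf_neq0 => i _; apply: torus_neq0.
by rewrite -[LHS]p1; congr (_ * _); apply: eq_bigl => i; rewrite finset.in_setC.
Qed.

Lemma Ft_M3inv (a b c : R[i]) : Ft (M3inv (a, b, c)) =
  (a * c, b ^+ 2, b * ((a ^+ 2 + c ^+ 2) / 2), ((a ^+ 2 + c ^+ 2) / 2) ^+ 2).
Proof.
have n2 : (2 : R[i]) != 0 by rewrite pnatr_eq0.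
rewrite /M3inv /Ft; set y := (a - c) / _.
have -> : y ^+ 2 = - ((a - c) / 2) ^+ 2.
  by rewrite /y !expr_div_n exprMn sqrCi mulrN1 invrN mulrN.
by congr (_, _, _, _); field.
Qed.

Lemma f_E d v t : torus t -> M3 v = elsym3 t ->
  f_ d v = M3inv (elsym3 (tpow d t)).
Proof. by move=> tt vt; rewrite /f_ vt chebyshevE. Qed.

Lemma g_rho4 d v : Ft (f_ d (rho4 v)) = Ft (f_ d v).
Proof.
have [t tt et] := elsym3_onto (M3 v).
have i4 : ('i : R[i]) ^+ 4 = 1 by rewrite (exprM _ 2 2) sqrCi -signr_odd expr0.
have t't : torus (scale_t 'i t).
  by rewrite /torus /= -elsym4 elsymZ i4 mul1r elsym4.
rewrite (f_E _ tt (esym et)) (f_E _ t't); last first.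
  rewrite /elsym3 !elsymZ; case: v et => [[x y] z] [-> -> ->] /=.
  have i2 := sqrCi R[i].
  congr (_, _, _).
  - by ring: i2.
  - by rewrite i2 mulN1r.
  - have -> : ('i : R[i]) ^+ 3 = - 'i by rewrite exprS i2 mulrN1.
    by ring: i2.
have -> : tpow d (scale_t 'i t) = scale_t ('i ^+ d) (tpow d t).
  by apply: eq_from_tnth => i; rewrite !tnth_mktuple exprMn.
rewrite /elsym3 !elsymZ !Ft_M3inv.
have u4 : (('i : R[i]) ^+ d) ^+ 4 = 1 by rewrite exprAC i4 expr1n.
move: ('i ^+ d) u4 => u u4.
have n2 : (2 : R[i]) != 0 by rewrite pnatr_eq0.
by congr (_, _, _, _); field: u4.
Qed.

Lemma g_tau4 d v : Ft (f_ d (tau4 v)) = Ft (f_ d v).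
Proof.
have [t tt et] := elsym3_onto (M3 v).
have t't : torus (inv_t t).
  by rewrite /torus /= -elsym4 elsymV // elsym0.
rewrite (f_E _ tt (esym et)) (f_E _ t't); last first.
  rewrite /elsym3 !elsymV //; case: v et => [[x y] z] [-> -> ->] /=.
  by rewrite mulrN opprK.
have -> : tpow d (inv_t t) = inv_t (tpow d t).
  by apply: eq_from_tnth => i; rewrite !tnth_mktuple exprVn.
have td : torus (tpow d t).
  rewrite /torus /=; under eq_bigr do rewrite tnth_mktuple.
  by rewrite prodrXl tt expr1n.
rewrite /elsym3 !elsymV // !Ft_M3inv /=.
rewrite [_ ^+ 2 + _]addrC [elsym 3 _ * _]mulrC //.
Qed.

Lemma Ft_fiber (Z : Type) (h : C3 R -> Z) :
  (forall v, h (rho4 v) = h v) -> (forall v, h (tau4 v) = h v) ->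
  forall v w, Ft v = Ft w -> h v = h w.
Proof.
move=> hr ht.
have n2 : (2 : R[i]) != 0 by rewrite pnatr_eq0.
have sgn x y z x' y' : x ^+ 2 = x' ^+ 2 -> y ^+ 2 = y' ^+ 2 ->
    h (x, y, z) = h (x', y', z).
  have hy a b c : h (a, - b, c) = h (a, b, c) by rewrite -(ht (a, b, c)).
  have hx a b c : h (- a, b, c) = h (a, b, c).
    by rewrite -(hr (a, b, c)) -(hr (rho4 _)) /= opprK hy.
  move=> /eqP; rewrite eqf_sqr => /orP[]/eqP -> /eqP; rewrite eqf_sqr =>
    /orP[]/eqP ->; by rewrite ?hx ?hy.
have swp x y z : h (x, y, - z) = h (y, x, z).
  by rewrite -(hr (y, x, z)) /=; apply: sgn; rewrite ?sqrrN.
move=> [[x y] z] [[x' y'] z'] [e1 e2 e3 e4].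
have half (a b c e : R[i]) : a + b = c + e -> a - b = c - e -> a = c /\ b = e.
  move=> p m; have A : 2 * a = 2 * c.
    have -> : 2 * a = (a + b) + (a - b) by ring.
    by rewrite p m; ring.
  have {}A := mulfI n2 A; split=> //; move: p; rewrite A; exact: addrI.
have same : x ^+ 2 - y ^+ 2 = x' ^+ 2 - y' ^+ 2 -> h (x, y, z) = h (x', y', z).
  by move=> /(half _ _ _ _ e1)[? ?]; apply: sgn.
have opp : x ^+ 2 - y ^+ 2 = - (x' ^+ 2 - y' ^+ 2) ->
    h (x, y, z) = h (x', y', - z).
  rewrite opprB swp => e; rewrite addrC in e1; rewrite (addrC (x' ^+ 2)) in e1.
  have [||? ?] := half (x ^+ 2) (y ^+ 2) (y' ^+ 2) (x' ^+ 2) => //.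
    by rewrite addrC.
  by apply: sgn.
move/eqP: e4; rewrite eqf_sqr => e4.
have [z0|z0] := eqVneq z' 0.
  have z0' : z = 0 by apply/eqP; rewrite -sqrf_eq0 e2 z0 expr0n.
  rewrite z0' in same opp *; rewrite z0; move: e4 => /orP[]/eqP.
    exact: same.
  by move=> /opp; rewrite oppr0.
move/eqP: e2; rewrite eqf_sqr => /orP[]/eqP ez.
  by rewrite ez in same e3 *; apply: same; apply: (mulfI z0).
rewrite -[z']opprK -ez; apply: opp; apply: (mulfI z0).
by rewrite mulrN -e3 ez mulNr opprK.
Qed.

Lemma Ft_onto : range (@Ft R) = X_Q R.
Proof.
have n2 : (2 : R[i]) != 0 by rewrite pnatr_eq0.
apply/seteqP; split => [_ [[[x y] z] _ <-]|[[[p q] r] s]] /=.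
  by rewrite exprMn subrr.
move=> /eqP; rewrite subr_eq0 => /eqP rqs.
have [D Ds Dr] : exists2 D : R[i], D ^+ 2 = s & sqrtC q * D = r.
  have := sqrtCK s; have := sqrtCK q; set z := sqrtC q; set D := sqrtC s.
  move=> zq Ds; have /eqP : (z * D) ^+ 2 = r ^+ 2 by rewrite exprMn zq Ds.
  rewrite eqf_sqr => /orP[]/eqP e; first by exists D.
  by exists (- D); rewrite ?sqrrN // mulrN e opprK.
exists (sqrtC ((p + D) / 2), sqrtC ((p - D) / 2), sqrtC q) => //=.
rewrite !sqrtCK.
have -> : (p + D) / 2 - (p - D) / 2 = D by field.
by rewrite Ds Dr; congr (_, _, _, _); field.
Qed.

Lemma g_E d v : g_ d (Ft v) = Ft (f_ d v).
Proof.
apply: (Ft_fiber (g_rho4 d) (g_tau4 d)).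
exact: (@xgetI _ (0, 0, 0) [set v' | Ft v' = Ft v] v erefl).
Qed.

End WellDefined.

Definition A_h (R : realType) (p q r s : R[i]) : R[i] :=
  256 - 192 * p + 48 * p ^+ 2 - 4 * p ^+ 3 - 128 * q - 80 * p * q
  + p ^+ 2 * q + 16 * q ^+ 2 + 288 * r + 36 * p * r - 8 * q * r - 108 * s.

Definition S_A (R : realType) : set (C4 R) :=
  [set w | let: (p, q, r, s) := w in A_h p q r s = 0 /\ q * s - r ^+ 2 = 0].

Definition S_P (R : realType) : set (C4 R) :=
  [set w | let: (p, q, r, s) := w in p ^+ 2 - s = 0 /\ q * s - r ^+ 2 = 0].

Definition C_1 (R : realType) : set (C4 R) :=
  [set (t ^+ 2, (2 * t - 2) ^+ 2, (2 * t - 2) * t ^+ 2, t ^+ 4)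
     | t in [set: R[i]]].

Definition C_2 (R : realType) : set (C4 R) :=
  [set (4 * T, (T + 2) ^+ 2, 4 * T * (T + 2), 16 * T ^+ 2)
     | T in [set: R[i]]].

Definition G_A (R : realType) (u v : R[i]) : C4 R :=
  let m := u + 2 * v in
  let n := 2 * u + 4 * v + u * v ^+ 2 / 2 in
  (4 + 2 * u * v + v ^+ 2, m ^+ 2, m * n, n ^+ 2).

Definition orbit_g (R : realType) (d : nat) (w : C4 R) : set (C4 R) :=
  [set iter k (g_ d) w | k in [set k | (0 < k)%N]].

Definition K_ (R : realType) (d : nat) (V : set (C4 R)) : set (C4 R) :=
  [set w | V w /\ bounded_set (orbit_g d w : set (C4top R))].

Arguments S_A R _ : clear implicits.
Arguments S_P R _ : clear implicits.
Arguments C_1 R _ : clear implicits.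
Arguments C_2 R _ : clear implicits.

(* A chart of [S] around [x]: a homeomorphism [phi], with inverse [psi], from
   the relatively open set [S `&` W] onto the open subset [O] of the plane. *)
Definition chart_at (R : realType) (T : topologicalType) (S : set T) (x : T)
    (W : set T) (O : set (R * R)) (phi : T -> R * R) (psi : R * R -> T) : Prop :=
  [/\ open W, W x & open O] /\
  [/\ {within S `&` W, continuous phi}, {within O, continuous psi},
      forall y, (S `&` W) y -> O (phi y) /\ psi (phi y) = y
    & forall a, O a -> (S `&` W) (psi a) /\ phi (psi a) = a].

(* [S], with the subspace topology, is a real topological 2-manifold. *)
Definition real_surface (R : realType) (T : topologicalType) (S : set T) : Prop :=
  S !=set0 /\
  forall x, S x -> exists W O phi psi, @chart_at R T S x W O phi psi.

(* Main.v *)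
(* Write w = [from_torus t] with t_1 t_2 t_3 t_4 = 1; then [g_ d] acts by t |-> t^d. The
   coordinates of w bound the elementary symmetric functions of t, hence its entries, so for
   d >= 2 the orbit of w is bounded iff all |t_i| = 1. [A_h] is the discriminant, so S_A
   consists of the t with a double entry, and S_P of the t = (a, 1/a, b, 1/b); on unit t the
   traces a + 1/a fill [-2, 2], which gives the parametrisations of the two Julia sets. For
   w = G_A(u, v) one has p - n = (2 - v)^2 (1 - u/2) and p + n = (2 + v)^2 (1 + u/2) with
   n^2 = s, so p^2 = s forces u or v to be 2 or -2.

   Each of the two Julia sets is an embedded copy of the disc [-2, 2]^2 / (b ~ - b), and they are
   glued along the boundary: their union is a sphere. A chart around either closed disc
   squares b, seen as a complex number, and adds the other disc by inversion. Continuity in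
   both directions comes from compactness of the correspondence. *)
Require Import Defs.
From HB Require Import structures.
From mathcomp Require Import all_boot all_order all_algebra.
From mathcomp Require Import all_classical all_reals all_analysis.
From mathcomp Require Import complex.
From mathcomp Require Import ring lra.

Import Order.TTheory GRing.Theory Num.Theory.
Import numFieldNormedType.Exports.

Local Open Scope classical_set_scope.
Local Open Scope ring_scope.

Set Implicit Arguments.
Unset Strict Implicit.
Unset Printing Implicit Defensive.

(** * Continuity of real functions built from sums, products, norms and maxima *)

Section RealContinuity.
Context {R : realType} {X : topologicalType}.
Implicit Types f g : X -> R.

Lemma contD f g : continuous f -> continuous g -> continuous (fun z => f z + g z).
Proof. by move=> cf cg z; apply: cvgD; [exact: cf|exact: cg]. Qed.

Lemma contN f : continuous f -> continuous (fun z => - f z).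
Proof. by move=> cf z; apply: cvgN; exact: cf. Qed.

Lemma contM f g : continuous f -> continuous g -> continuous (fun z => f z * g z).
Proof. by move=> cf cg z; apply: cvgM; [exact: cf|exact: cg]. Qed.

Lemma contX f n : continuous f -> continuous (fun z => f z ^+ n).
Proof.
move=> cf; elim: n => [|n IHn]; first exact: cst_continuous.
by under eq_fun do rewrite exprS; exact: contM.
Qed.

Lemma cont_norm f : continuous f -> continuous (fun z => `|f z|).
Proof. by move=> cf z; apply: cvg_norm; exact: cf. Qed.

Lemma cont_max f g :
  continuous f -> continuous g -> continuous (fun z => Num.max (f z) (g z)).
Proof. by move=> cf cg z; apply: continuous_max; [exact: cf|exact: cg]. Qed.

Lemma cont_cst (c : R) : continuous (fun _ : X => c).
Proof. by move=> z; exact: cvg_cst. Qed.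

Lemma cont_pair {Y Z : topologicalType} (f : X -> Y) (g : X -> Z) :
  continuous f -> continuous g -> continuous (fun z => (f z, g z)).
Proof. by move=> cf cg z; apply: cvg_pair; [exact: cf|exact: cg]. Qed.

Lemma cont_fst {Y Z : topologicalType} (f : X -> Y * Z) :
  continuous f -> continuous (fun z => (f z).1).
Proof.
by move=> cf z; apply: (@continuous_comp _ _ _ f fst); [exact: cf|exact: cvg_fst].
Qed.

Lemma cont_snd {Y Z : topologicalType} (f : X -> Y * Z) :
  continuous f -> continuous (fun z => (f z).2).
Proof.
by move=> cf z; apply: (@continuous_comp _ _ _ f snd); [exact: cf|exact: cvg_snd].
Qed.

Lemma cont_id : continuous (fun z : X => z).
Proof. by move=> z; exact: cvg_id. Qed.

Lemma cont_closed_le f (c : R) : continuous f -> closed [set z | f z <= c].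
Proof.
move=> cf; apply: (@closed_comp _ _ f [set x | x <= c]); last exact: closed_le.
by move=> z _; exact: cf.
Qed.

Lemma cont_open_lt f (c : R) : continuous f -> open [set z | f z < c].
Proof.
move=> cf; apply: (@open_comp _ _ f [set x | x < c]); last exact: open_lt.
by move=> z _; exact: cf.
Qed.

End RealContinuity.

Ltac continuity :=
  repeat first [ assumption | lazymatch goal with
  | |- continuous (fun x => x) => exact: cont_id
  | |- continuous fst => exact: (cont_fst (@cont_id _))
  | |- continuous snd => exact: (cont_snd (@cont_id _))
  | |- continuous (fun _ => ?c) => exact: cont_cst
  | |- continuous (fun x => (@?f x, @?g x)) => apply: (@cont_pair _ _ _ f g)
  | |- continuous (fun x => (@?f x).1) => apply: (@cont_fst _ _ _ f)
  | |- continuous (fun x => (@?f x).2) => apply: (@cont_snd _ _ _ f)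
  | |- continuous (fun x => Num.max (@?f x) (@?g x)) => apply: (@cont_max _ _ f g)
  | |- continuous (fun x => `|@?f x|) => apply: (@cont_norm _ _ f)
  | |- continuous (fun x => @?f x + @?g x) => apply: (@contD _ _ f g)
  | |- continuous (fun x => - @?f x) => apply: (@contN _ _ f)
  | |- continuous (fun x => @?f x ^+ ?n) => apply: (@contX _ _ f n)
  | |- continuous (fun x => @?f x * @?g x) => apply: (@contM _ _ f g)
  end ].

(** * Charts from compact correspondences *)

(** For [V] open around [f x], the points below the part of [K] that [q] sends outside [V] form the
    image of a compact set, hence a closed set. Its complement is a neighbourhood of [x] that [f]
    maps into [V] on [D]. *)
Lemma compact_correspondence_continuous (X Y Z : topologicalType) (K : set Z)
    (p : Z -> X) (q : Z -> Y) (D : set X) (f : X -> Y) :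
  hausdorff_space X -> compact K -> continuous p -> continuous q ->
  D `<=` p @` K -> (forall z, K z -> D (p z) -> q z = f (p z)) ->
  {within D, continuous f}.
Proof.
move=> hX cK cp cq DK qf; apply/subspace_continuousP => x Dx U.
rewrite /= nbhsE => -[V [oV Vx] VU].
pose B := p @` (K `&` q @^-1` (~` V)).
have clB : closed B.
  apply: compact_closed => //; apply: continuous_compact.
    exact: continuous_subspaceT.
  apply: compact_closedI => //; apply: closed_comp => [z _|]; first exact: cq.
  exact: open_closedC.
have : nbhs x (~` B).
  apply: open_nbhs_nbhs; split; first exact: closed_openC.
  by move=> [z [Kz /= Vz] zx]; apply: Vz; rewrite qf ?zx.
apply: filterS => y By Dy; apply: VU; apply: contrapT => Vy; apply: By.
have [z Kz zy] := DK _ Dy.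
by exists z => //; split => //=; rewrite qf ?zy.
Qed.

(** [G] need only be bijective over [O]. Removing from [S] the closed set [S'] and the points paired
    with a parameter outside [O] leaves a relatively open set on which [G] is the graph of a
    bijection. Compactness of [G] then makes both directions continuous. *)
Lemma correspondence_chart (R : realType) (T : topologicalType)
    (G : set ((R * R) * T)) (S S' : set T) (O : set (R * R)) a0 x :
  hausdorff_space T -> compact G -> closed S' -> open O ->
  (forall a y, G (a, y) -> S y) ->
  (forall y, S y -> S' y \/ exists a, G (a, y)) ->
  (forall a, O a -> exists y, G (a, y)) ->
  (forall a y a' y', G (a, y) -> G (a', y') -> O a -> (a = a' <-> y = y')) ->
  (forall a y, G (a, y) -> O a -> ~ S' y) ->
  O a0 -> G (a0, x) ->
  exists W O phi psi, @chart_at R T S x W O phi psi.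
Proof.
move=> hT cG cS' oO GS SG OG Ginj GS' Oa0 Gx.
pose W := ~` (S' `|` snd @` (G `&` fst @^-1` (~` O))).
have cfst : continuous (@fst (R * R) T) by move=> z; exact: cvg_fst.
have csnd : continuous (@snd (R * R) T) by move=> z; exact: cvg_snd.
have GW a y : G (a, y) -> O a -> W y.
  move=> Gay Oa [|[[a' y'] [Ga' /= Oa'] yy']]; first exact: GS' Gay Oa.
  by apply: Oa'; rewrite -(Ginj _ _ _ _ Gay Ga' Oa).2.
pose phi y := xget a0 [set a | G (a, y)].
pose psi a := xget x [set y | G (a, y)].
have Gphi y : (S `&` W) y -> G (phi y, y).
  move=> [Sy Wy]; have [S'y|[a Ga]] := SG _ Sy; first by case: Wy; left.
  exact: (@xgetI _ a0 [set a | G (a, y)] _ Ga).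
have Gpsi a : O a -> G (a, psi a).
  move=> /OG[y Gy]; exact: (@xgetI _ x [set y | G (a, y)] _ Gy).
have Ophi y : (S `&` W) y -> O (phi y).
  move=> SWy; have := Gphi _ SWy; case: SWy => _ Wy Gy.
  by apply: contrapT => Oy; apply: Wy; right; exists (phi y, y).
have phiE a y : G (a, y) -> O a -> phi y = a.
  move=> Gay Oa; apply/esym/(Ginj _ _ _ _ Gay (Gphi y _) Oa) => //.
  by split; [exact: GS Gay|exact: GW Gay Oa].
have psiE a y : G (a, y) -> O a -> psi a = y.
  by move=> Gay Oa; apply/esym/(Ginj _ _ _ _ Gay (Gpsi a Oa) Oa).
exists W, O, phi, psi; split; split => //.
- apply: closed_openC; apply: closedU => //; apply: compact_closed => //.
  apply: continuous_compact; first exact: continuous_subspaceT.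
  apply: compact_closedI => //; apply: closed_comp => //.
  exact: open_closedC.
- exact: GW Gx Oa0.
- apply: (@compact_correspondence_continuous _ _ _ G snd fst) => //.
    by move=> y /Gphi; exists (phi y, y).
  move=> [a y] Gay SWy /=; apply/esym/phiE => //; apply: contrapT => Oa.
  by case: SWy => _; apply; right; exists (a, y).
- apply: (@compact_correspondence_continuous _ _ _ G fst snd) => //.
  + by move=> a /Gpsi; exists (a, psi a).
  + by move=> [a y] Gay /= Oa; apply/esym/psiE.
- by move=> y SWy; split; [exact: Ophi|apply: psiE; [exact: Gphi|exact: Ophi]].
- move=> a Oa; have Ga := Gpsi a Oa; split; last exact: phiE.
  by split; [exact: GS Ga|exact: GW Ga Oa].
Qed.

(** * Complex squaring as a model of the plane modulo b ~ - b *)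

Definition supn {R : realType} (b : R * R) : R := Num.max `|b.1| `|b.2|.
Definition dilate {R : realType} (k : R) (b : R * R) : R * R := (k * b.1, k * b.2).
Definition csq {R : realType} (b : R * R) : R * R :=
  (b.1 ^+ 2 - b.2 ^+ 2, 2 * b.1 * b.2).

Section SignQuotient.
Context {R : realType}.
Implicit Types (a b : R * R) (k : R).

(** The square of a complex number determines its modulus, so u^2 + v^2 is known besides u^2 - v^2
    and u v. This fixes (u, v) up to a common sign. *)
Lemma csq_eq a b : csq a = csq b <-> a = b \/ a = dilate (-1) b.
Proof.
case: a b => [u v] [u' v']; rewrite /csq /dilate /=; split; last first.
  by case=> -[-> ->] //; congr (_, _); ring.
case=> e1 e2.
have h : (u ^+ 2 + v ^+ 2) ^+ 2 = (u' ^+ 2 + v' ^+ 2) ^+ 2.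
  have -> : (u ^+ 2 + v ^+ 2) ^+ 2 = (u ^+ 2 - v ^+ 2) ^+ 2 + (2 * u * v) ^+ 2.
    by ring.
  by rewrite e1 e2; ring.
have {}h : u ^+ 2 + v ^+ 2 = u' ^+ 2 + v' ^+ 2.
  by move/eqP: h; rewrite eqrXn2 // ?addr_ge0 ?sqr_ge0 // => /eqP.
have hu : u ^+ 2 = u' ^+ 2 by lra.
have hv : v ^+ 2 = v' ^+ 2 by lra.
have huv : u * v = u' * v' by lra.
move/eqP: hu; rewrite eqf_sqr => /orP[]/eqP hu; subst u.
  have [u0|u0] := eqVneq u' 0; last by left; rewrite (mulfI u0 huv).
  move/eqP: hv; rewrite eqf_sqr => /orP[]/eqP ->; rewrite u0; [left|right] => //.
  by congr (_, _); ring.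
have [u0|u0] := eqVneq u' 0.
  move/eqP: hv; rewrite eqf_sqr => /orP[]/eqP ->; rewrite u0; [left|right] => //;
  by congr (_, _); ring.
by right; congr (_, _); [ring|apply: (mulfI u0); lra].
Qed.

Lemma csq_onto w : exists a, csq a = w.
Proof.
case: w => p q.
pose n := Num.sqrt (p ^+ 2 + q ^+ 2).
have n2 : n ^+ 2 = p ^+ 2 + q ^+ 2 by rewrite sqr_sqrtr // addr_ge0 ?sqr_ge0.
have n0 : 0 <= n by rewrite sqrtr_ge0.
have pn : 0 <= n + p /\ 0 <= n - p.
  have : `|p| <= n.
    by rewrite -sqrtr_sqr ler_wsqrtr // lerDl sqr_ge0.
  by rewrite ler_norml => /andP[? ?]; split; lra.
case: pn => np pn.
(* These are the absolute values of the real and imaginary parts of a square root of p + i q of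
   modulus n; the sign of [v] is then adjusted to that of [q]. *)
pose u := Num.sqrt ((n + p) / 2); pose v := Num.sqrt ((n - p) / 2).
have u2 : u ^+ 2 = (n + p) / 2 by rewrite sqr_sqrtr // divr_ge0.
have v2 : v ^+ 2 = (n - p) / 2 by rewrite sqr_sqrtr // divr_ge0.
have : (2 * u * v) ^+ 2 = q ^+ 2.
  by rewrite !exprMn u2 v2; lra.
move/eqP; rewrite eqf_sqr => /orP[]/eqP e.
  by exists (u, v); rewrite /csq /= u2 v2 e; congr (_, _); lra.
by exists (u, - v); rewrite /csq /= sqrrN u2 v2 mulrN e opprK; congr (_, _); lra.
Qed.

Lemma supn_dilate k a : supn (dilate k a) = `|k| * supn a.
Proof. by rewrite /supn /= !normrM maxr_pMr. Qed.

Lemma dilate_dilate k l a : dilate k (dilate l a) = dilate (k * l) a.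
Proof. by rewrite /dilate /= !mulrA. Qed.

Lemma dilate1 a : dilate 1 a = a.
Proof. by case: a => u v; rewrite /dilate /= !mul1r. Qed.

Lemma csq_dilate k a : csq (dilate k a) = dilate (k ^+ 2) (csq a).
Proof. by rewrite /csq /dilate /=; congr (_, _); ring. Qed.

Lemma csq_supn a b : csq a = csq b -> supn a = supn b.
Proof.
by move/csq_eq => -[->|->] //; rewrite supn_dilate normrN1 mul1r.
Qed.

(* The image under [csq] of the open square [supn b < 4], by a polynomial inequality. *)
Definition supn_lt4 (w : R * R) : Prop := w.2 ^+ 2 + 64 * `|w.1| < 1024.

(** With U = u^2 >= V = v^2 the inequality reads 4 (U - 16) (V + 16) < 0, that is U < 16; the case U
    <= V is symmetric. *)
Lemma supn_lt4P a : supn_lt4 (csq a) <-> supn a < 4.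
Proof.
have lt4 (x : R) : (`|x| < 4) = (x ^+ 2 < 16).
  rewrite -(@ltr_pXn2r _ 2) ?nnegrE //= real_normK ?num_real //.
  by congr (_ < _); ring.
case: a => u v; rewrite /supn_lt4 /supn /csq /= gt_max !lt4.
have -> : (2 * u * v) ^+ 2 = 4 * u ^+ 2 * v ^+ 2 by ring.
have := sqr_ge0 u; have := sqr_ge0 v; set U := u ^+ 2; set V := v ^+ 2 => V0 U0.
split=> [|/andP[hu hv]].
  have [h|h] := ler0P (U - V) => lt1; apply/andP; split; nra.
have [h|h] := ler0P (U - V); nra.
Qed.

End SignQuotient.

(** * Two discs glued along their boundaries *)

Section Pillow.
Context {R : realType} {T : topologicalType}.
Hypothesis hT : hausdorff_space T.

(* [D] is the graph of an embedding of the square [supn b <= 2] modulo [b ~ - b], except that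
   only one of [b] and [- b] need occur in it. *)
Definition pillow_face (D : set ((R * R) * T)) : Prop :=
  [/\ compact D,
      forall b y, D (b, y) -> supn b <= 2,
      forall b, supn b <= 2 -> exists2 b', csq b' = csq b & exists y, D (b', y)
    & forall b y b' y', D (b, y) -> D (b', y') -> (csq b = csq b' <-> y = y')].

Definition glued (D D' : set ((R * R) * T)) : Prop :=
  forall b y b' y', D (b, y) -> D' (b', y') ->
    (csq b = csq b' /\ supn b = 2 <-> y = y').

Lemma gluedC D D' : glued D D' -> glued D' D.
Proof.
move=> g b y b' y' Dy Dy'; split=> [[e s]|e].
  by apply/esym/(g _ _ _ _ Dy' Dy); rewrite e -(csq_supn e).
by have [e' s] := (g _ _ _ _ Dy' Dy).2 (esym e); rewrite e' (csq_supn (esym e')).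
Qed.

Lemma glued_chart (D D' : set ((R * R) * T)) x :
  pillow_face D -> pillow_face D' -> glued D D' -> (exists a, D (a, x)) ->
  exists W O phi psi,
    @chart_at R T (snd @` D `|` snd @` D') x W O phi psi.
Proof.
move=> [cD D2 Dex Dinj] [cD' D'2 D'ex D'inj] DD' [a Da].
(* Inversion in [supn b = 2] puts the second face around the first one. *)
pose lam b : R := 4 / (Num.max (supn b) 1) ^+ 2.
have lam1 b : 1 <= supn b -> lam b = 4 / (supn b) ^+ 2.
  by rewrite /lam => /max_idPl ->.
have lamN b : 1 <= supn b -> supn (dilate (lam b) b) = 4 / supn b.
  move=> b1; have b0 : supn b != 0 by rewrite gt_eqF // (lt_le_trans ltr01).
  rewrite supn_dilate lam1 // ger0_norm ?divr_ge0 ?sqr_ge0 //.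
  by field.
pose inv b := csq (dilate (lam b) b).
(* Since [inv b] determines 4 / [supn b], it determines the nonzero factor [lam b], which can then
   be cancelled. *)
have inv_eq b b' : 1 <= supn b -> 1 <= supn b' ->
    (inv b = inv b' <-> csq b = csq b').
  move=> b1 b'1; split=> e.
    have : lam b = lam b'.
      have := csq_supn e; rewrite !lamN // !lam1 // => /(mulfI _) h.
      by rewrite -!exprVn h // pnatr_eq0.
    move: e; rewrite /inv !csq_dilate => + E; rewrite -E.
    have l0 : lam b ^+ 2 != 0.
      rewrite lam1 // expf_neq0 // mulf_neq0 ?pnatr_eq0 // invr_neq0 //.
      by rewrite expf_neq0 // gt_eqF // (lt_le_trans ltr01).
    case: (csq b) (csq b') => [u v] [u' v'] [/(mulfI l0) -> /(mulfI l0) ->] //.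
  by rewrite /inv !csq_dilate e /lam (csq_supn e).
(* The band 1 <= [supn] <= 2 of the second face is sent to 2 <= [supn] <= 4 before squaring. Its
   core [supn] <= 1 stays outside the chart as [S'], and the common rim [supn] = 1 goes to the
   boundary of [O]. *)
pose G := (fun z => (csq z.1, z.2)) @` D
   `|` (fun z => (inv z.1, z.2)) @` (D' `&` [set z | 1 <= supn z.1]).
pose S' := snd @` (D' `&` [set z | supn z.1 <= 1]).
pose O : set (R * R) := [set w | supn_lt4 w].
have csupn : continuous (fun z : (R * R) * T => supn z.1).
  by rewrite /supn; continuity.
have cS' : closed S'.
  apply: compact_closed => //; apply: continuous_compact.
    by apply: continuous_subspaceT; continuity.
  by apply: compact_closedI => //; exact: cont_closed_le.
have cG : compact G.
  apply: compactU; apply: continuous_compact => //.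
  - by apply: continuous_subspaceT; rewrite /csq; continuity.
  - apply: continuous_subspaceT; rewrite /inv /csq /dilate /=.
    (* The maximum with 1 in [lam] keeps the denominator nonzero, so [lam] is continuous on the
       whole plane. *)
    have clam : continuous (fun z : (R * R) * T => lam z.1).
      have cm : continuous (fun z : (R * R) * T => Num.max (supn z.1) 1 ^+ 2).
        by rewrite /supn; continuity.
      apply: contM; first exact: cont_cst.
      move=> z; apply: cvgV.
        by rewrite expf_neq0 // gt_eqF // lt_max ltr01 orbT.
      exact: cm.
    by continuity.
  - apply: compact_closedI => //.
    have -> : [set z : (R * R) * T | 1 <= supn z.1] = [set z | - supn z.1 <= - 1].
      by apply/seteqP; split => z /=; rewrite lerN2.
    by apply: cont_closed_le; exact: contN.
have oO : open O by apply: cont_open_lt; continuity.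
have Osupn b : O (csq b) -> supn b < 4 by move/supn_lt4P.
apply: (@correspondence_chart R T G _ S' O (csq a) x) => //.
- move=> w y [[[b z] Db [_ <-]]|[[b z] [Db _] [_ <-]]]; [left|right]; by exists (b, z).
- move=> y [[[b z] Db /= <-]|[[b z] Db /= <-]].
    by right; exists (csq b); left; exists (b, z).
  have [b1|b1] := leP (supn b) 1; first by left; exists (b, z).
  by right; exists (inv b); right; exists (b, z) => //; split=> //=; exact: ltW.
- move=> w; have [b <- Ob] := csq_onto w.
  have [b2|b2] := leP (supn b) 2.
    by have [b' e [y Dy]] := Dex _ b2; exists y; left; exists (b', y); rewrite //= e.
  have b4 := Osupn _ Ob.
  (* Inversion is an involution: the inverse of [b] lies in the band of the second face, and
     inverting it again gives [b]. *)
  pose b' := dilate (4 / (supn b) ^+ 2) b.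
  have b0 : supn b != 0 by rewrite gt_eqF // (lt_trans _ b2).
  have b'N : supn b' = 4 / supn b.
    rewrite supn_dilate ger0_norm ?divr_ge0 ?sqr_ge0 //; by field.
  have b'2 : supn b' <= 2 by rewrite b'N ler_pdivrMr; lra.
  have b'1 : 1 <= supn b' by rewrite b'N ler_pdivlMr; lra.
  have [b'' e [y Dy]] := D'ex _ b'2.
  exists y; right; exists (b'', y); first by split => //=; rewrite (csq_supn e).
  rewrite /=; congr (_, _).
  rewrite (inv_eq _ b' _ b'1).2 ?(csq_supn e) // /inv lam1 // b'N /b' dilate_dilate.
  have -> : 4 / (4 / supn b) ^+ 2 * (4 / supn b ^+ 2) = 1 by field.
  by rewrite dilate1.
(* The equality [csq b = inv b'] gives [supn b] = 4 / [supn b'] with both norms at most 2. Both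
   points are thus on the boundary, where inversion is the identity and the gluing applies. *)
- have mixed b z b' z' : D (b, z) -> D' (b', z') -> 1 <= supn b' ->
      csq b = inv b' <-> z = z'.
    move=> Db Db' b'1; split.
      move=> e.
      have := csq_supn e; rewrite lamN // => s.
      have b'2 := D'2 _ _ Db'; have b2 := D2 _ _ Db.
      have b'e : supn b' = 2.
        have b'0 : 0 < supn b' by rewrite (lt_le_trans ltr01).
        by move: b2; rewrite s ler_pdivrMr //; lra.
      apply/(DD' _ _ _ _ Db Db'); rewrite e s b'e; split; last by lra.
      rewrite /inv lam1 // b'e.
      have -> : 4 / 2 ^+ 2 = 1 :> R by field.
      by rewrite dilate1.
    move/(DD' _ _ _ _ Db Db') => [e s]; rewrite e /inv lam1 // -(csq_supn e) s.
    have -> : 4 / 2 ^+ 2 = 1 :> R by field.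
    by rewrite dilate1.
  move=> w y w' y' [[[b z] Db [<- <-]]|[[b z] [Db b1] [<- <-]]]
    [[[b' z'] Db' [<- <-]]|[[b' z'] [Db' b'1] [<- <-]]] _ /=.
  + exact: Dinj.
  + exact: mixed.
  + by split=> e; apply/esym; apply/(mixed _ _ _ _ Db' Db b1); rewrite e.
  + by rewrite inv_eq //; exact: D'inj.
- move=> w y [[[b z] Db [<- <-]]|[[b z] [Db b1] [<- <-]]] Ow [[b' z'] [Db' /= b'1] zz'].
    have [e s] := (DD' _ _ _ _ Db Db').2 (esym zz').
    by move: b'1; rewrite -(csq_supn e) s; lra.
  (* A point of both the band and the core has norm 1, so its parameter comes from norm 4, outside
     [O]. *)
  have e := (D'inj _ _ _ _ Db Db').2 (esym zz').
  move: b'1; rewrite -(csq_supn e) => b'1; have be : supn b = 1.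
    by apply/eqP; rewrite eq_le b'1.
  by have := Osupn _ Ow; rewrite lamN // be; lra.
- by rewrite /O /=; apply/supn_lt4P; rewrite (le_lt_trans (D2 _ _ Da)) //; lra.
- by left; exists (a, x).
Qed.
End Pillow.

(** * The two faces and their common boundary *)

Section Faces.
Variable R : realType.
Implicit Types (b : R * R).

(** Both Julia sets consist of real points. The faces are therefore computed in R^4 and then carried
    into C^4. *)
Definition realpt (y : R * R * R * R) : C4top R :=
  let: (p, q, r, s) := y in (p%:C%C, q%:C%C, r%:C%C, s%:C%C).

Lemma realpt_inj : injective realpt.
Proof.
move=> [[[p q] r] s] [[[p' q'] r'] s'] e.
by move: e => [] /= <- <- <- <-.
Qed.

Lemma continuous_real_complex : continuous (fun x : R => x%:C%C : (R[i])^o).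
Proof.
move=> x; apply/cvgrPdist_lt => e e0.
have eR : e = (complex.Re e)%:C%C by rewrite RRe_real // gtr0_real.
have e0' : 0 < complex.Re e by move: e0; rewrite eR ltcR.
near=> t.
rewrite -rmorphB /= eR normc_def /= expr0n addr0 sqrtr_sqr ltcR.
by near: t; apply: cvgr_dist_lt.
Unshelve. all: by end_near. Qed.

Lemma continuous_realpt : continuous realpt.
Proof.
have -> : realpt = fun y => (y.1.1.1%:C%C, y.1.1.2%:C%C, y.1.2%:C%C, y.2%:C%C).
  by apply/funext => -[[[]]].
have c (f : R * R * R * R -> R) : continuous f ->
    continuous (fun y => (f y)%:C%C : (R[i])^o).
  move=> cf y; apply: (@continuous_comp _ _ _ f (fun x : R => x%:C%C : (R[i])^o)).
    exact: cf.
  exact: continuous_real_complex.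
have c1 := c (fun y => y.1.1.1) ltac:(continuity).
have c2 := c (fun y => y.1.1.2) ltac:(continuity).
have c3 := c (fun y => y.1.2) ltac:(continuity).
have c4 := c (fun y => y.2) ltac:(continuity).
exact: (cont_pair (cont_pair (cont_pair c1 c2) c3) c4).
Qed.

Definition GA b : R * R * R * R :=
  let m := b.1 + 2 * b.2 in
  let n := 2 * b.1 + 4 * b.2 + b.1 * b.2 ^+ 2 / 2 in
  (4 + 2 * b.1 * b.2 + b.2 ^+ 2, m ^+ 2, m * n, n ^+ 2).

(** For t = (a, 1/a, a', 1/a') whose two traces are the entries of [b], one has e_1 = e_3 = x and
    e_2 = z. *)
Definition GP b : R * R * R * R :=
  let x := b.1 + b.2 in
  let z := 2 + b.1 * b.2 in
  (x ^+ 2, z ^+ 2, z * x ^+ 2, x ^+ 4).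

Definition square : set (R * R) := [set b | supn b <= 2].
Definition wedge : set (R * R) := [set b | `|b.2| <= b.1 <= 2].

(* The Klein four-group generated by [(c, e) |-> (e, c)] and [(c, e) |-> (- c, - e)] preserves
   [GP], and [wedge] is a fundamental domain. Moving the wedge into the square by [wedge_pos]
   makes [GP] agree with [GA] on the boundary [supn b = 2] and turns the remaining
   identification of [GP], on the edge [e = - c], into [b ~ - b]. *)
Definition wedge_pos b : R * R := (b.1 ^+ 2 - 2, 2 + b.1 * (b.2 - b.1) / 2).

Definition faceA : set ((R * R) * C4top R) :=
  (fun b => (b, realpt (GA b))) @` square.
Definition faceP : set ((R * R) * C4top R) :=
  (fun b => (wedge_pos b, realpt (GP b))) @` wedge.

Lemma squareP b : square b <-> [/\ -2 <= b.1, b.1 <= 2, -2 <= b.2 & b.2 <= 2].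
Proof.
rewrite /square /supn /= ge_max !ler_norml.
by split=> [/andP[/andP[? ?] /andP[? ?]]|[-> -> -> ->]].
Qed.

Lemma wedgeP b : wedge b <-> [/\ -b.1 <= b.2, b.2 <= b.1 & b.1 <= 2].
Proof.
rewrite /wedge /= ler_norml.
by split=> [/andP[/andP[? ?] ?]|[-> -> ->]].
Qed.

Lemma compact_square : compact square.
Proof.
have -> : square = `[(-2 : R), 2]%classic `*` `[(-2 : R), 2]%classic.
  apply/seteqP; split => b; rewrite squareP /= !in_itv /=.
    by case=> -> -> -> ->.
  by case=> /andP[? ?] /andP[? ?].
by apply: compact_setX; exact: segment_compact.
Qed.

Lemma compact_wedge : compact wedge.
Proof.
have -> : wedge = square `&` [set b | `|b.2| - b.1 <= 0].
  apply/seteqP; split => b; rewrite /setI /= squareP subr_le0 wedgeP.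
    by case=> ? ? ?; rewrite ler_norml; split; [split|apply/andP; split]; lra.
  by case=> -[? ? ? ?]; rewrite ler_norml => /andP[? ?]; split; lra.
apply: compact_closedI; first exact: compact_square.
by apply: cont_closed_le; continuity.
Qed.

Lemma compact_faceA : compact faceA.
Proof.
apply: continuous_compact compact_square; apply: continuous_subspaceT.
have c : continuous (fun b => realpt (GA b)).
  move=> b; apply: continuous_comp; last exact: continuous_realpt.
  by move: b; rewrite -/(continuous GA) /GA; continuity.
by continuity.
Qed.

Lemma compact_faceP : compact faceP.
Proof.
apply: continuous_compact compact_wedge; apply: continuous_subspaceT.
have c : continuous (fun b => realpt (GP b)).
  move=> b; apply: continuous_comp; last exact: continuous_realpt.
  by move: b; rewrite -/(continuous GP) /GP; continuity.
by rewrite /wedge_pos; continuity.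
Qed.

(** The data fix the square of m + i n, hence m + i n up to sign. *)
Lemma sqr_prod_eq (m n m' n' : R) :
  m ^+ 2 = m' ^+ 2 -> m * n = m' * n' -> n ^+ 2 = n' ^+ 2 ->
  (m = m' /\ n = n') \/ (m = - m' /\ n = - n').
Proof.
move=> em emn en.
have e : csq (m, n) = csq (m', n').
  by rewrite /csq /= em en -!mulrA emn.
by have [[-> ->]|[-> ->]] := (csq_eq _ _).1 e; [left|right; split; ring].
Qed.

(** The last three coordinates fix (m, n) up to a common sign, which b -> - b absorbs. With u
    eliminated through m, both remaining differences are divisible by v - v', and the two cofactors
    together give (v - v')^2 = 0. *)
Lemma GA_inj (b b' : R * R) : GA b = GA b' -> csq b = csq b'.
Proof.
have core (u v u' v' : R) : 2 * u * v + v ^+ 2 = 2 * u' * v' + v' ^+ 2 ->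
    u + 2 * v = u' + 2 * v' ->
    2 * u + 4 * v + u * v ^+ 2 / 2 = 2 * u' + 4 * v' + u' * v' ^+ 2 / 2 ->
    (u, v) = (u', v').
  move=> e1 em en; have {em}eu : u = u' + 2 * v' - 2 * v by lra.
  subst u; have [-> |ne] := eqVneq v v'; first by congr (_, _); ring.
  exfalso; have d0 : v - v' != 0 by rewrite subr_eq0.
  have h1 : 2 * (u' + 2 * v') - 3 * (v + v') = 0 by apply: (mulfI d0); lra.
  have h2 : (u' + 2 * v') * (v + v') - 2 * (v ^+ 2 + v * v' + v' ^+ 2) = 0.
    by apply: (mulfI d0); lra.
  have eu : u' = 3 / 2 * (v + v') - 2 * v' by lra.
  have : (v - v') ^+ 2 = 0 by move: h2; rewrite eu => h2; lra.
  by move/eqP; rewrite sqrf_eq0 (negbTE d0).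
case: b b' => [u v] [u' v']; rewrite /GA /= => -[e1 e2 e3 e4]; rewrite csq_eq.
have [[em en]|[em en]] := sqr_prod_eq e2 e3 e4; [left|right].
  by apply: core => //; lra.
by rewrite /dilate /=; apply: core; lra.
Qed.

Lemma GAN b : GA (dilate (-1) b) = GA b.
Proof. by case: b => u v; rewrite /GA /dilate /=; congr (_, _, _, _); ring. Qed.

Lemma faceAP b y : faceA (b, y) <-> square b /\ y = realpt (GA b).
Proof.
split=> [[b' Sb' /pair_equal_spec[e <-]]|[Sb ->]]; last by exists b.
by rewrite -e.
Qed.

Lemma facePP b y :
  faceP (b, y) <-> exists2 c, wedge c & b = wedge_pos c /\ y = realpt (GP c).
Proof.
split=> [[c wc /pair_equal_spec[<- <-]]|[c wc [-> ->]]]; by exists c.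
Qed.

Lemma faceA_pillow : pillow_face (faceA).
Proof.
split.
- exact: compact_faceA.
- by move=> b y /faceAP[].
- by move=> b b2; exists b => //; exists (realpt (GA b)); apply/faceAP.
- move=> b y b' y' /faceAP[_ ->] /faceAP[_ ->]; split.
    by move/csq_eq => -[->//|->]; rewrite GAN.
  by move/realpt_inj/GA_inj.
Qed.

(** For (u, v) = [wedge_pos (c, e)] one has u + v = c (c + e) / 2, so the image of the wedge lies in
    the half u + v >= 0 of the square. Up to b ~ - b this half is enough, and there c and e are
    found by solving c^2 = u + 2 and then the linear equation for e. *)
Lemma wedge_pos_onto b : supn b <= 2 -> 
  exists2 c, wedge c & csq (wedge_pos c) = csq b.
Proof.
wlog s0 : b / 0 <= b.1 + b.2 => [h b2|].
  have [/h/(_ b2)//|s0] := leP 0 (b.1 + b.2).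
  have [||c wc e] := h (dilate (-1) b); first by rewrite /dilate /=; lra.
    by rewrite supn_dilate normrN1 mul1r.
  by exists c => //; rewrite e; apply/csq_eq; right.
case: b s0 => u v /= s0 /squareP/= [u1 u2 v1 v2].
pose c := Num.sqrt (u + 2).
have cc : c ^+ 2 = u + 2 by rewrite sqr_sqrtr; lra.
have c0 : 0 <= c by exact: sqrtr_ge0.
have c2 : c <= 2.
  by rewrite -(@ler_pXn2r _ 2) ?nnegrE // cc; lra.
(* At c = 0 the equation for e degenerates; u + v >= 0 leaves only the corner (-2, 2), the image of
   the apex of the wedge. *)
have [c00|cn0] := eqVneq c 0.
  exists (0, 0); first by apply/wedgeP; rewrite /=; split; lra.
  have u' : u = -2 by move: cc; rewrite c00 expr0n /=; lra.
  have v' : v = 2 by lra.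
  by congr csq; rewrite /wedge_pos u' v' /=; congr (_, _); ring.
have cp : 0 < c by rewrite lt0r cn0.
exists (c, c - 2 * (2 - v) / c).
  apply/wedgeP => /=; split => //.
    rewrite -subr_ge0.
    have -> : c - 2 * (2 - v) / c - - c = 2 * (c ^+ 2 - 2 + v) / c by field.
    by rewrite cc divr_ge0 //; lra.
  by rewrite gerBl divr_ge0 //; lra.
congr csq; rewrite /wedge_pos /= cc; congr (_, _); first by ring.
by field.
Qed.

(** The sum c + e is the nonnegative root of the first coordinate. Where it is nonzero, the third
    coordinate gives z, hence c e, and c - e >= 0 follows. On the edge e = - c only z^2 is left, and
    the change of sign of z = 2 - c^2 becomes b ~ - b. *)
Lemma GP_inj (c c' : R * R) : wedge c -> wedge c' ->
  csq (wedge_pos c) = csq (wedge_pos c') <-> GP c = GP c'.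
Proof.
case: c c' => [c e] [c' e'] /wedgeP/= [l1 l2 l3] /wedgeP/= [l1' l2' l3'].
have c0 : 0 <= c by lra.
have c0' : 0 <= c' by lra.
have sq (x x' : R) : 0 <= x -> 0 <= x' -> x ^+ 2 = x' ^+ 2 -> x = x'.
  by move=> x0 x0' /eqP; rewrite eqrXn2 // => /eqP.
rewrite csq_eq /wedge_pos /GP /dilate /=; split.
  case=> -[ec ee].
    have {}ec : c = c' by apply: sq => //; lra.
    subst c'; have [c00|cn0] := eqVneq c 0.
      have [-> ->] : e = 0 /\ e' = 0 by split; lra.
      by [].
    by have -> : e = e' by apply: (mulfI cn0); lra.
  (* Both images have u + v = c (c + e) / 2 >= 0; being opposite, both sums vanish, which puts both
     points on the edge e = - c. *)
  have s0 : 0 <= c * (c + e) by rewrite mulr_ge0 //; lra.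
  have s0' : 0 <= c' * (c' + e') by rewrite mulr_ge0 //; lra.
  have {}s0 : c * (c + e) = 0 by lra.
  have {}s0' : c' * (c' + e') = 0 by lra.
  have z (x y : R) : 0 <= x -> y <= x -> -x <= y -> x * (x + y) = 0 -> y = -x.
    by move=> ? ? ? /eqP; rewrite mulf_eq0 => /orP[]/eqP ?; lra.
  have {s0} ? := z _ _ c0 l2 l1 s0; have {s0'} ? := z _ _ c0' l2' l1' s0'; subst e e'.
  have h : c' ^+ 2 = 4 - c ^+ 2 by lra.
  have -> : 2 + c' * - c' = - (2 + c * - c) by lra.
  by rewrite !subrr; congr (_, _, _, _); ring.
case=> e1 e2 e3 _.
have ex : c + e = c' + e' by apply: sq => //; lra.
have same : c * e = c' * e' -> c = c' /\ e = e'.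
  move=> ep; have : c - e = c' - e'.
    apply: sq; [lra|lra|].
    have -> : (c - e) ^+ 2 = (c + e) ^+ 2 - 4 * (c * e) by ring.
    by rewrite ex ep; ring.
  by split; lra.
have [x0|x0] := eqVneq (c' + e') 0.
  have ee : e = - c by lra.
  have ee' : e' = - c' by lra.
  subst e e'.
  move/eqP: e2; rewrite eqf_sqr => /orP[]/eqP h.
    by have [|-> _] := same; [lra|left].
  by right; congr (_, _); lra.
move: e3; rewrite ex => /(mulIf (expf_neq0 2 x0)) e3.
by have [|-> ->] := same; [lra|left].
Qed.

Lemma faceP_pillow : pillow_face (faceP).
Proof.
split.
- exact: compact_faceP.
- move=> b y /facePP[[c e] /wedgeP/= [l1 l2 l3] [-> _]]; apply/squareP => /=.
  have c0 : 0 <= c by lra.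
  by split; nra.
- move=> b /wedge_pos_onto[c wc e]; exists (wedge_pos c) => //.
  by exists (realpt (GP c)); apply/facePP; exists c.
- move=> b y b' y' /facePP[c wc [-> ->]] /facePP[c' wc' [-> ->]].
  by rewrite GP_inj //; split=> [->//|/realpt_inj].
Qed.

(** The boundary comes from c = 2, where t = (1, 1, a', 1/a'), from e = c, where t = (a, a, 1/a,
    1/a), and from the apex. On the two edges t has a double entry, and [wedge_pos] gives its
    parameters for [GA]. *)
Lemma wedge_pos_boundary (c : R * R) : wedge c -> supn (wedge_pos c) = 2 ->
  GA (wedge_pos c) = GP c.
Proof.
case: c => c e /wedgeP/= [l1 l2 l3] s.
have c0 : 0 <= c by lra.
have : c = 0 \/ c = 2 \/ e = c.
  (* The four cases are u = -2, u = 2, v = 2 and v = -2. The last one forces c = 2, since c <= 2 and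
     c - e <= 2 c. *)
  have key : [\/ c ^+ 2 = 0, c ^+ 2 = 4, c * (c - e) = 0 | c * (c - e) = 8].
    move: s; rewrite /supn /= maxEge.
    case: ifP => _ /eqP; rewrite eqr_norml => /andP[/orP[]/eqP h _].
    - by constructor 2; lra.
    - by constructor 1; lra.
    - by constructor 3; lra.
    - by constructor 4; lra.
  case: key => [/eqP|h|/eqP|h].
  - by rewrite sqrf_eq0 => /eqP; left.
  - right; left; apply/eqP; rewrite -(@eqrXn2 _ 2) //; apply/eqP; lra.
  - by rewrite mulf_eq0 => /orP[]/eqP; [left|right; right; lra].
  - by right; left; nra.
case=> [|[]] h; subst; rewrite /GA /GP /wedge_pos /=.
- have -> : e = 0 by lra.
  by congr (_, _, _, _); field.
- by congr (_, _, _, _); field.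
- by congr (_, _, _, _); field.
Qed.

Lemma GA_boundary (u v p q r : R) : GA (u, v) = (p, q, r, p ^+ 2) ->
  [\/ u = 2, u = - 2, v = 2 | v = -2].
Proof.
case=> <- _ _ e.
have : (2 - v) ^+ 2 * (1 - u / 2) * ((2 + v) ^+ 2 * (1 + u / 2)) = 0 by lra.
by move/eqP; rewrite mulf_eq0 => /orP[]; rewrite mulf_eq0 => /orP[];
  rewrite ?sqrf_eq0 => /eqP h; [constructor 3|constructor 1|constructor 4|constructor 2]; lra.
Qed.

Lemma faces_glued : glued (faceA) (faceP).
Proof.
move=> b y b' y' /faceAP[bS ->] /facePP[c wc [-> ->]]; split.
  move=> [e s]; congr realpt; rewrite -wedge_pos_boundary // -?(csq_supn e) //.
  by move/csq_eq: e => -[->//|->]; rewrite GAN.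
move/realpt_inj => e.
have s : supn b = 2.
  apply/eqP; rewrite eq_le (_ : supn b <= 2) //=.
  case: b e {bS} => u v e.
  have := @GA_boundary u v ((c.1 + c.2) ^+ 2) ((2 + c.1 * c.2) ^+ 2)
    ((2 + c.1 * c.2) * (c.1 + c.2) ^+ 2).
  rewrite e /GP -exprM => /(_ erefl).
  rewrite /supn /= le_max.
  by case=> ->; rewrite ?normrN normr_nat lexx ?orbT.
split => //.
(* Representing [b] by [c'] in the wedge turns the common point into an equality of values of [GP],
   to which [GP_inj] applies. *)
have [c' wc' e'] := wedge_pos_onto bS.
rewrite -e'; apply/GP_inj => //; rewrite -e -wedge_pos_boundary //.
  by move/csq_eq: e' => -[->//|->]; rewrite GAN.
by rewrite (csq_supn e').
Qed.

Lemma faces_surface :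
  @real_surface R (C4top R) (snd @` faceA `|` snd @` faceP).
Proof.
have hT : hausdorff_space (C4top R) by exact: norm_hausdorff.
split.
  exists (realpt (GA (0, 0))); left; exists ((0, 0), realpt (GA (0, 0))) => //.
  by exists (0, 0) => //; apply/squareP => /=; split; lra.
move=> x [[[b y] Fb <-]|[[b y] Fb <-]].
  by apply: (glued_chart hT faceA_pillow faceP_pillow faces_glued); exists b.
rewrite setUC.
apply: (glued_chart hT faceP_pillow faceA_pillow (gluedC faces_glued)).
by exists b.
Qed.

End Faces.

(** * Torus coordinates and bounded orbits *)

Section Dynamics.
Variable R : realType.
Local Notation C := (R[i]).
Implicit Types (t : 4.-tuple C) (w : C4 R) (a b c e : C).

(** Through [coef_elsym] the sums over subsets are read off as coefficients of one expanded
    product. *)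
Lemma elsym3_tuple4 a b c e : elsym3 [tuple a; b; c; e] =
  (a + b + c + e, a * b + a * c + a * e + b * c + b * e + c * e,
   a * b * c + a * b * e + a * c * e + b * c * e).
Proof.
pose p : {poly C} := \poly_(i < 5) [:: a * b * c * e;
  - (a * b * c + a * b * e + a * c * e + b * c * e);
  a * b + a * c + a * e + b * c + b * e + c * e; - (a + b + c + e); 1]`_i.
have E : \prod_(x <- [tuple a; b; c; e]) ('X - x%:P) = p.
  rewrite /p poly_def !big_ord_recl big_ord0 /= !big_cons big_nil.
  rewrite -!mul_polyC !(polyCD, polyCM, polyCN) /bump /=; ring.
have h j := @coef_elsym R [tuple a; b; c; e] j; rewrite E /p in h.
rewrite /elsym3; congr (_, _, _).
- by have := h 1 isT; rewrite coef_poly /= expr1 mulN1r => /oppr_inj.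
- by have := h 2 isT; rewrite coef_poly /= sqrrN expr1n mul1r.
- by have := h 3 isT; rewrite coef_poly /= -signr_odd expr1 mulN1r => /oppr_inj.
Qed.

Lemma torus_tuple4 a b c e : torus [tuple a; b; c; e] <-> a * b * c * e = 1.
Proof.
rewrite /torus /= !big_ord_recl big_ord0 !(tnth_nth 0) /= mulr1 !mulrA.
by [].
Qed.

Lemma tpow_tuple4 d a b c e :
  tpow d [tuple a; b; c; e] = [tuple a ^+ d; b ^+ d; c ^+ d; e ^+ d].
Proof.
apply: eq_from_tnth => i; rewrite tnth_mktuple !(tnth_nth 0).
by case: i => [[|[|[|[|]]]]].
Qed.

Definition from_torus t : C4 R := Ft (M3inv (elsym3 t)).

Lemma from_torus_onto w : X_Q R w -> exists2 t, torus t & from_torus t = w.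
Proof.
rewrite -(@Ft_onto R) => -[v _ <-].
have [t tt et] := elsym3_onto (M3 v); exists t => //.
by rewrite /from_torus et M3K.
Qed.

Lemma from_torus_XQ t : X_Q R (from_torus t).
Proof. by rewrite -(@Ft_onto R); exists (M3inv (elsym3 t)). Qed.

Lemma g_from_torus d t : torus t -> g_ d (from_torus t) = from_torus (tpow d t).
Proof. by move=> tt; rewrite /from_torus g_E (f_E d tt) // M3invK. Qed.

Lemma torus_tpow d t : torus t -> torus (tpow d t).
Proof.
move=> tt; rewrite /torus /=; under eq_bigr do rewrite tnth_mktuple.
by rewrite prodrXl tt expr1n.
Qed.

Lemma iter_g_from_torus d k t : torus t ->
  iter k (g_ d) (from_torus t) = from_torus (tpow (d ^ k)%N t).
Proof.
move=> tt; elim: k => [|k IHk] /=.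
  congr from_torus; apply: eq_from_tnth => i.
  by rewrite tnth_mktuple expn0 expr1.
rewrite IHk g_from_torus; last exact: torus_tpow.
congr from_torus; apply: eq_from_tnth => i.
by rewrite !tnth_mktuple -exprM mulnC expnS.
Qed.

(** Each entry is a root of the quartic with coefficients [elsym j t]. Solved for the leading term,
    the equation bounds the entry by the coefficients. *)
Lemma root_torus t i : torus t ->
  tnth t i ^+ 4 = elsym 1 t * tnth t i ^+ 3 - elsym 2 t * tnth t i ^+ 2
                  + elsym 3 t * tnth t i - 1.
Proof.
case/tupleP: t => a t; case/tupleP: t => b t; case/tupleP: t => c t.
case/tupleP: t => e t; rewrite (tuple0 t) => /torus_tuple4 h.
have [-> -> ->] := elsym3_tuple4 a b c e; rewrite -h.
set x := tnth _ _.
have : (x - a) * (x - b) * (x - c) * (x - e) = 0.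
  rewrite /x; case: i {x} => [[|[|[|[|//]]]]] i4; rewrite (tnth_nth 0) /=; ring.
move=> E; apply/eqP; rewrite -subr_eq0 -E; apply/eqP; ring.
Qed.

(** The norm on [R[i]] takes values in [R[i]]; [nc] is the same modulus with values in [R], where
    the arithmetic tactics apply. *)
Local Notation nc := (@ComplexField.Normc.normc R).

Lemma normr_nc (z : C) : `|z| = (nc z)%:C%C. Proof. by []. Qed.

Lemma max_real_complex (x y : R) :
  Num.max x%:C%C y%:C%C = (Num.max x y)%:C%C :> C.
Proof. by rewrite /Order.max ltcR; case: ifP. Qed.

Lemma norm_C4 (p q r s : C) : `|(p, q, r, s) : C4top R| =
  (Num.max (Num.max (Num.max (nc p) (nc q)) (nc r)) (nc s))%:C%C.
Proof. by rewrite !prod_normE /= !normr_nc !max_real_complex. Qed.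

Lemma bounded_C4P (A : set (C4 R)) : bounded_set (A : set (C4top R)) <->
  exists M : R, forall p q r s, A (p, q, r, s) ->
    [/\ nc p <= M, nc q <= M, nc r <= M & nc s <= M].
Proof.
split=> [/pinfty_ex_gt0[M M0 AM]|[M AM]].
  exists (complex.Re M) => p q r s Aw; have := AM _ Aw.
  have MR : M = (complex.Re M)%:C%C by rewrite RRe_real // gtr0_real.
  rewrite /= norm_C4 [in X in _ <= X]MR lecR !ge_max.
  by move=> /andP[/andP[/andP[]]].
exists M%:C%C; split; first by rewrite complex_real.
move=> M' MM' [[[p q] r] s] /AM[? ? ? ?] /=; apply: le_trans (ltW MM').
by rewrite norm_C4 lecR !ge_max; do !(apply/andP; split).
Qed.

Lemma ncX (x : C) n : nc (x ^+ n) = nc x ^+ n.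
Proof.
by elim: n => [|n IHn]; rewrite ?ComplexField.Normc.normc1 // !exprS
  ComplexField.Normc.normcM IHn.
Qed.

Lemma nc_ge0 (x : C) : 0 <= nc x.
Proof. by case: x => u v; rewrite sqrtr_ge0. Qed.

Lemma nc_half (x : C) : nc (x / 2) = nc x / 2.
Proof.
by rewrite ComplexField.Normc.normcM ComplexField.Normc.normcV normcMn
  ComplexField.Normc.normc1.
Qed.

Lemma nc_elsym j t : (forall i, nc (tnth t i) = 1) ->
  nc (elsym j t) <= #|{set 'I_4}|%:R.
Proof.
move=> t1; have : `|elsym j t| <= (#|{set 'I_4}|%:R : C).
  apply: le_trans (ler_norm_sum _ _ _) _.
  rewrite (eq_bigr (fun=> 1)) => [|A _]; last first.
    by rewrite normr_prod big1 // => i _; rewrite normr_nc t1.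
  by rewrite sumr_const ler_nat max_card.
by rewrite normr_nc -(rmorph_nat (real_complex R)) lecR.
Qed.

(* The coordinates of [Ft (M3inv (a, b, c))] control [a c] and [a^2 + c^2], hence [a + c] and
   [a - c]. *)
Lemma Ft_bound_inv (M : R) a b c p q r s : 1 <= M ->
  Ft (M3inv (a, b, c)) = (p, q, r, s) ->
  [/\ nc p <= M, nc q <= M, nc r <= M & nc s <= M] ->
  [/\ nc a <= 4 * M, nc b <= M & nc c <= 4 * M].
Proof.
move=> M1; rewrite Ft_M3inv => -[<- <- _ <-] [hp hq _ hs].
have sq (x B : R) : 0 <= x -> 0 <= B -> x ^+ 2 <= B ^+ 2 -> x <= B.
  by move=> x0 B0; rewrite ler_pXn2r.
move: hq hs; rewrite !ncX nc_half => hq hs.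
have hb : nc b <= M by apply: sq; [exact: nc_ge0|lra|nra].
have hac : nc (a ^+ 2 + c ^+ 2) / 2 <= M.
  by apply: sq; [rewrite divr_ge0 ?nc_ge0|lra|nra].
have hp2 : nc (2 * (a * c)) <= 2 * M.
  rewrite mulr_natl; have := le_normcD (a * c) (a * c); rewrite -mulr2n; lra.
have hD : nc (a + c) <= 4 * M.
  apply: sq; [exact: nc_ge0|lra|]; rewrite -ncX.
  have -> : (a + c) ^+ 2 = (a ^+ 2 + c ^+ 2) + 2 * (a * c) by ring.
  by have := le_normcD (a ^+ 2 + c ^+ 2) (2 * (a * c)); nra.
have hB : nc (a - c) <= 4 * M.
  apply: sq; [exact: nc_ge0|lra|]; rewrite -ncX.
  have -> : (a - c) ^+ 2 = (a ^+ 2 + c ^+ 2) + (- (2 * (a * c))) by ring.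
  by have := le_normcD (a ^+ 2 + c ^+ 2) (- (2 * (a * c))); rewrite normcN; nra.
split => //.
  have -> : a = ((a + c) + (a - c)) / 2 by field.
  by rewrite nc_half; have := le_normcD (a + c) (a - c); lra.
have -> : c = ((a + c) + (c - a)) / 2 by field.
by rewrite nc_half; have := le_normcD (a + c) (c - a); rewrite -(normcN (c - a)) opprB; lra.
Qed.

(** If x > 1, Bernoulli's inequality and k < d^k give x^(d^k) > k (x - 1), which exceeds any [B]. *)
Lemma bernoulli_unbounded (x B : R) d : (1 < d)%N ->
  (forall k, (0 < k)%N -> x ^+ (d ^ k) <= B) -> x <= 1.
Proof.
move=> d1 xB; rewrite leNgt; apply/negP => x1.
have h0 : 0 < x - 1 by rewrite subr_gt0.
have bern n : 1 + n%:R * (x - 1) <= x ^+ n.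
  elim: n => [|n IHn]; first by rewrite mul0r addr0 expr0.
  rewrite exprS; apply: (le_trans _ (ler_wpM2l _ IHn)); last by lra.
  rewrite -natr1; have n0 : 0 <= (n%:R : R) by [].
  by have := mulr_ge0 n0 (sqr_ge0 (x - 1)); lra.
have B0 : 0 <= B.
  by apply: le_trans (xB 1%N isT); rewrite exprn_ge0 //; lra.
pose k := Num.bound (B / (x - 1)).
have kB : B < k%:R * (x - 1).
  by rewrite -ltr_pdivrMr // archi_boundP // divr_ge0 // ltW.
have k0 : (0 < k)%N.
  by rewrite lt0n; apply/eqP => k0; move: kB; rewrite k0 mul0r ltNge B0.
have := xB k k0; apply/negP; rewrite -ltNge.
apply: (lt_le_trans kB); apply: le_trans (ler_weXn2l (ltW x1) (ltnW (ltn_expl k d1))).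
by have := bern k; lra.
Qed.

Lemma bounded_orbit_torus d t : (1 < d)%N -> torus t ->
  bounded_set (orbit_g d (from_torus t) : set (C4top R)) <->
  forall i, `|tnth t i| = 1.
Proof.
move=> d1 tt; rewrite bounded_C4P; split=> [[M0 bM]|t1].
  pose M := Num.max M0 1.
  have M1 : 1 <= M by rewrite le_max lexx orbT.
  have le1 j : nc (tnth t j) <= 1.
    (* A root with modulus x > 10 M would satisfy x^4 <= (4 M + M + 4 M + 1) x^3 <= 10 M x^3, as M
       >= 1. *)
    apply: (@bernoulli_unbounded _ (10 * M) d d1) => k k0.
    have tk := torus_tpow (d ^ k) tt.
    have := root_torus j tk; rewrite tnth_mktuple => E.
    case Ew: (from_torus (tpow (d ^ k) t)) => [[[p q] r] s].
    have [|p1 q1 r1 s1] := bM p q r s.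
      by exists k => //; rewrite iter_g_from_torus.
    have [|h1 h2 h3] := Ft_bound_inv M1 Ew; first by split; rewrite le_max; apply/orP; left.
    rewrite -ncX; move: (tnth t j ^+ _) E => y E; set x := nc y; set a := elsym 1 _ in E h1.
    set b := elsym 2 _ in E h2; set c := elsym 3 _ in E h3.
    have x0 : 0 <= x by exact: nc_ge0.
    rewrite leNgt; apply/negP => xM.
    clearbody a b c.
    have x4 : x ^+ 4 <= 4 * M * x ^+ 3 + M * x ^+ 2 + 4 * M * x + 1.
      rewrite -ncX E; apply: le_trans (le_normcD _ _) _.
      rewrite normcN ComplexField.Normc.normc1 lerD2r.
      apply: le_trans (le_normcD _ _) _; apply: lerD; last first.
        by rewrite ComplexField.Normc.normcM ler_wpM2r.
      apply: le_trans (le_normcD _ _) _; rewrite normcN.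
      apply: lerD; rewrite ComplexField.Normc.normcM ncX ler_wpM2r //;
        by rewrite exprn_ge0.
    have x1 : 1 <= x by lra.
    have x3 : 1 <= x ^+ 3 by rewrite exprn_ege1.
    have x13 : x <= x ^+ 3 by rewrite -[leLHS]expr1 ler_weXn2l.
    have x23 : x ^+ 2 <= x ^+ 3 by rewrite ler_weXn2l.
    have : 0 < x ^+ 3 * (x - 10 * M) by rewrite mulr_gt0; lra.
    have : 0 <= M * (x ^+ 3 - x ^+ 2) by rewrite mulr_ge0; lra.
    have : 0 <= M * (x ^+ 3 - x) by rewrite mulr_ge0; lra.
    have : 0 <= (M - 1) * (x ^+ 3 - 1) by rewrite mulr_ge0; lra.
    lra.
  (* Four moduli that are at most 1 and multiply to 1 are all equal to 1. *)
  move=> i; apply/eqP; rewrite eq_le {1}normr_nc lecR le1 /=.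
  have : `|\prod_(j < 4) tnth t j| = 1 by rewrite tt normr1.
  rewrite normr_prod (bigD1 i) //= => <-.
  rewrite ler_piMr // prodr_ile1 // => j _.
  by rewrite normr_ge0 normr_nc lecR le1.
pose B : R := #|{set 'I_4}|%:R.
have B0 : 0 <= B by [].
exists (B ^+ 2 + B ^+ 3 + B ^+ 4) => p q r s [k _].
rewrite iter_g_from_torus // /from_torus /elsym3 Ft_M3inv => -[<- <- <- <-].
have tk i : nc (tnth (tpow (d ^ k) t) i) = 1.
  have /(congr1 (@complex.Re R)) /= := t1 i.
  by rewrite tnth_mktuple ncX => ->; rewrite expr1n.
have := nc_elsym 1 tk; have := nc_elsym 2 tk; have := nc_elsym 3 tk.
rewrite -/B; move: (elsym 1 _) (elsym 2 _) (elsym 3 _) => a b c hc hb ha.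
have [a0 [b0 c0]] := (nc_ge0 a, (nc_ge0 b, nc_ge0 c)).
have hac : nc ((a ^+ 2 + c ^+ 2) / 2) <= B ^+ 2.
  rewrite nc_half; have := le_normcD (a ^+ 2) (c ^+ 2); rewrite !ncX.
  have : nc a ^+ 2 <= B ^+ 2 by rewrite ler_pXn2r.
  have : nc c ^+ 2 <= B ^+ 2 by rewrite ler_pXn2r.
  lra.
have B2 : 0 <= B ^+ 2 by [rewrite exprn_ge0].
have B3 : 0 <= B ^+ 3 by [rewrite exprn_ge0].
have B4 : 0 <= B ^+ 4 by [rewrite exprn_ge0].
rewrite !ncX !ComplexField.Normc.normcM; split.
- have := ler_pM a0 c0 ha hc; lra.
- have : nc b ^+ 2 <= B ^+ 2 by [rewrite ler_pXn2r]; lra.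
- have := ler_pM b0 (nc_ge0 _) hb hac.
  have -> : B * B ^+ 2 = B ^+ 3 by rewrite exprS.
  by rewrite ComplexField.Normc.normcM; lra.
- have : nc ((a ^+ 2 + c ^+ 2) / 2) ^+ 2 <= (B ^+ 2) ^+ 2.
    by rewrite ler_pXn2r ?nnegrE ?nc_ge0.
  by rewrite -exprM ComplexField.Normc.normcM; lra.
Qed.
End Dynamics.

(** * Torus descriptions of [S_A] and [S_P] *)

Section Surfaces.
Variable R : realType.
Local Notation C := (R[i]).
Implicit Types (t : 4.-tuple C) (w : C4 R) (a b c e : C).

Lemma from_torus_tuple4 a b c e : from_torus [tuple a; b; c; e] =
  let e1 := a + b + c + e in
  let e2 := a * b + a * c + a * e + b * c + b * e + c * e in
  let e3 := a * b * c + a * b * e + a * c * e + b * c * e in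
  (e1 * e3, e2 ^+ 2, e2 * ((e1 ^+ 2 + e3 ^+ 2) / 2), ((e1 ^+ 2 + e3 ^+ 2) / 2) ^+ 2).
Proof. by rewrite /from_torus elsym3_tuple4 Ft_M3inv. Qed.

(* [A_h] is the discriminant of [X^4 - e1 X^3 + e2 X^2 - e3 X + e4], specialised at [e4 = 1]. *)
Lemma A_h_discriminant a b c e p q r s : a * b * c * e = 1 ->
  from_torus [tuple a; b; c; e] = (p, q, r, s) ->
  A_h p q r s = ((a - b) * (a - c) * (a - e) * (b - c) * (b - e) * (c - e)) ^+ 2.
Proof.
rewrite from_torus_tuple4 => e4 [<- <- <- <-].
(* Keeping e_4 as a variable k makes the right-hand side the full discriminant, so its comparison
   with the product of differences is a polynomial identity. The value k = 1 enters only in the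
   comparison with [A_h]. *)
have disc (e1 e2 e3 k : C) : k = 1 ->
    A_h (e1 * e3) (e2 ^+ 2) (e2 * ((e1 ^+ 2 + e3 ^+ 2) / 2))
      (((e1 ^+ 2 + e3 ^+ 2) / 2) ^+ 2) =
    256 * k ^+ 3 - 192 * e1 * e3 * k ^+ 2 - 128 * e2 ^+ 2 * k ^+ 2
    + 144 * e2 * e3 ^+ 2 * k - 27 * e3 ^+ 4 + 144 * e1 ^+ 2 * e2 * k ^+ 2
    - 6 * e1 ^+ 2 * e3 ^+ 2 * k - 80 * e1 * e2 ^+ 2 * e3 * k
    + 18 * e1 * e2 * e3 ^+ 3 + 16 * e2 ^+ 4 * k - 4 * e2 ^+ 3 * e3 ^+ 2
    - 27 * e1 ^+ 4 * k ^+ 2 + 18 * e1 ^+ 3 * e2 * e3 * k - 4 * e1 ^+ 3 * e3 ^+ 3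
    - 4 * e1 ^+ 2 * e2 ^+ 3 * k + e1 ^+ 2 * e2 ^+ 2 * e3 ^+ 2.
  by move=> ->; rewrite /A_h; field.
by rewrite (disc _ _ _ _ e4); ring.
Qed.

Lemma S_A_torus w : S_A R w <->
  exists a b c, a * a * b * c = 1 /\ w = from_torus [tuple a; a; b; c].
Proof.
split; last first.
  move=> [a [b [c [h ->]]]]; have := from_torus_XQ [tuple a; a; b; c].
  case E: (from_torus [tuple a; a; b; c]) => [[[p q] r] s] hX; split.
    by rewrite (A_h_discriminant h E) subrr !mul0r expr0n.
  by apply/eqP; rewrite -oppr_eq0 opprB hX.
move=> Sw; have [t tt tw] : exists2 t, torus t & from_torus t = w.
  apply: from_torus_onto; case: w Sw => [[[p q] r] s] [_ /= h].
  by apply/eqP; rewrite -oppr_eq0 opprB h.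
subst w; move: tt Sw.
case/tupleP: t => a t; case/tupleP: t => b t; case/tupleP: t => c t.
case/tupleP: t => e t; rewrite (tuple0 t) => /torus_tuple4 tt Sw.
have : ((a - b) * (a - c) * (a - e) * (b - c) * (b - e) * (c - e)) ^+ 2 = 0.
  case E: (from_torus [tuple a; b; c; e]) Sw => [[[p q] r] s] [Ah _].
  by rewrite -(A_h_discriminant tt E).
(* [from_torus] depends only on the symmetric functions, so the double entry can be moved to the
   front. *)
have perm (a' b' c' e' : C) : 
    a + b + c + e = a' + b' + c' + e' ->
    a * b + a * c + a * e + b * c + b * e + c * e =
    a' * b' + a' * c' + a' * e' + b' * c' + b' * e' + c' * e' ->
    a * b * c + a * b * e + a * c * e + b * c * e =
    a' * b' * c' + a' * b' * e' + a' * c' * e' + b' * c' * e' ->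
    from_torus [tuple a; b; c; e] = from_torus [tuple a'; b'; c'; e'].
  by rewrite !from_torus_tuple4 /= => -> -> ->.
move/eqP; rewrite sqrf_eq0 !mulf_eq0 !subr_eq0 -!orbA.
case/or4P => [/eqP h|/eqP h|/eqP h|/or3P[]/eqP h]; subst.
- by exists b, c, e.
- by exists c, b, e; split; [rewrite -tt; ring|apply: perm; ring].
- by exists e, b, c; split; [rewrite -tt; ring|apply: perm; ring].
- by exists c, a, e; split; [rewrite -tt; ring|apply: perm; ring].
- by exists e, a, c; split; [rewrite -tt; ring|apply: perm; ring].
- by exists e, a, b; split; [rewrite -tt; ring|apply: perm; ring].
Qed.

(** The two parameters are traces of pairs with product 1, namely (a^2, b c) and (a b, a c); hence
    they are real when the entries have modulus 1. *)
Lemma from_torus_G_A a b c : a * a * b * c = 1 ->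
  from_torus [tuple a; a; b; c] = G_A (a * a + b * c) (a * b + a * c).
Proof.
by move=> h; rewrite from_torus_tuple4 /G_A /=; congr (_, _, _, _); field: h.
Qed.

Definition H_P (c e : C) : C4 R :=
  let x := c + e in
  let z := 2 + c * e in
  (x ^+ 2, z ^+ 2, z * x ^+ 2, x ^+ 4).

Lemma from_torus_H_P a a' b b' : a * a' = 1 -> b * b' = 1 ->
  from_torus [tuple a; a'; b; b'] = H_P (a + a') (b + b').
Proof.
move=> ha hb; rewrite from_torus_tuple4 /=.
have -> : a * a' * b + a * a' * b' + a * b * b' + a' * b * b' =
    a + a' + b + b' by rewrite ha -mulrA -[a' * b * b']mulrA hb; ring.
have -> : a * a' + a * b + a * b' + a' * b + a' * b' + b * b' =
    2 + (a + a') * (b + b') by rewrite ha hb; ring.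
by rewrite /H_P; congr (_, _, _, _); field.
Qed.

Lemma trace_onto (u : C) : exists a a' : C, a * a' = 1 /\ a + a' = u.
Proof.
have := sqrtCK (u ^+ 2 - 4); set y := sqrtC _ => yy.
exists ((u + y) / 2), ((u - y) / 2); split; last by field.
by have -> : (u + y) / 2 * ((u - y) / 2) = (u ^+ 2 - y ^+ 2) / 4 by [field]; rewrite yy; field.
Qed.

Lemma S_P_torus w : S_P R w <->
  exists a a' b b', [/\ a * a' = 1, b * b' = 1 & w = from_torus [tuple a; a'; b; b']].
Proof.
split; last first.
  move=> [a [a' [b [b' [ha hb ->]]]]]; rewrite from_torus_H_P // /H_P /=.
  by split; ring.
case: w => [[[p q] r] s] [/= /eqP]; rewrite subr_eq0 => /eqP <- /eqP.
rewrite subr_eq0 => /eqP qs.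
have [z zz zp] : exists2 z : C, z ^+ 2 = q & z * p = r.
  have := sqrtCK q; set z := sqrtC q => zq.
  have /eqP : (z * p) ^+ 2 = r ^+ 2 by rewrite exprMn zq.
  rewrite eqf_sqr => /orP[]/eqP e; first by exists z.
  by exists (- z); rewrite ?sqrrN // mulNr e opprK.
have := sqrtCK p; set x := sqrtC p => xx.
(* With x = e_1 and z = e_2, the two traces have sum x and product z - 2, so they are the roots of
   X^2 - x X + (z - 2). *)
have := sqrtCK (x ^+ 2 - 4 * (z - 2)); set y := sqrtC _ => yy.
have [a [a' [ha eu]]] := trace_onto ((x + y) / 2).
have [b [b' [hb ev]]] := trace_onto ((x - y) / 2).
exists a, a', b, b'; split => //; rewrite from_torus_H_P // eu ev /H_P.
have -> : (x + y) / 2 + (x - y) / 2 = x by field.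
have -> : 2 + (x + y) / 2 * ((x - y) / 2) = z.
  have -> : (x + y) / 2 * ((x - y) / 2) = (x ^+ 2 - y ^+ 2) / 4 by field.
  by rewrite yy; field.
by rewrite zz xx zp (exprM x 2 2) xx.
Qed.

Lemma unit_trace (x y : C) : x * y = 1 -> `|x| = 1 ->
  exists2 u : R, -2 <= u <= 2 & x + y = u%:C%C.
Proof.
move=> xy x1; have x0 : x != 0 by rewrite -normr_eq0 x1 oner_eq0.
have -> : y = x^*%C by rewrite -[y](mulKf x0) xy mulr1 invc_norm x1 expr1n invr1 mul1r.
exists (2 * complex.Re x); last by rewrite addcJ rmorphM rmorph_nat.
have := normc_ge_Re x; rewrite x1 -(rmorph1 (real_complex R)) lecR ler_norml.
by move=> /andP[? ?]; lra.
Qed.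

Lemma unit_trace_onto (u : R) : -2 <= u <= 2 ->
  exists x y : C, [/\ x * y = 1, `|x| = 1, `|y| = 1 & x + y = u%:C%C].
Proof.
move=> /andP[u1 u2].
have s0 : 0 <= 1 - (u / 2) ^+ 2 by nra.
pose s := Num.sqrt (1 - (u / 2) ^+ 2).
have ss : s ^+ 2 = 1 - (u / 2) ^+ 2 by rewrite sqr_sqrtr.
exists ((u / 2) +i* s)%C, ((u / 2) -i* s)%C; split.
- by apply/eqP; rewrite eq_complex /=; apply/andP; split; apply/eqP; lra.
- by rewrite normc_def /= ss subrKC sqrtr1.
- by rewrite normc_def /= sqrrN ss subrKC sqrtr1.
- by apply/eqP; rewrite eq_complex /=; apply/andP; split; apply/eqP; lra.
Qed.

End Surfaces.

(** * The Julia sets, their intersection and invariance *)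

Section JuliaSets.
Variable R : realType.
Local Notation C := (R[i]).
Implicit Types (w : C4 R) (a b c : C).

Lemma tnth_tuple4 (P : C -> Prop) (a b c e : C) :
  (forall i, P (tnth [tuple a; b; c; e] i)) <-> [/\ P a, P b, P c & P e].
Proof.
split=> [h|[ha hb hc he] i].
  split; [have := h (inord 0)|have := h (inord 1)|have := h (inord 2)|
    have := h (inord 3)]; by rewrite (tnth_nth 0) inordK.
by rewrite (tnth_nth 0); case: i => [[|[|[|[|]]]]].
Qed.

Lemma K_S_A d w : (1 < d)%N -> K_ d (S_A R) w <->
  exists a b c, [/\ a * a * b * c = 1, `|a| = 1, `|b| = 1, `|c| = 1
    & w = from_torus [tuple a; a; b; c]].
Proof.
move=> d1; split.
  move=> [/S_A_torus[a [b [c [h ->]]]]].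
  move/(bounded_orbit_torus d1 ((torus_tuple4 a a b c).2 h)).
  by move/(tnth_tuple4 (fun z => `|z| = 1)) => -[ha _ hb hc]; exists a, b, c.
move=> [a [b [c [h ha hb hc ->]]]]; split.
  by apply/S_A_torus; exists a, b, c.
apply/(bounded_orbit_torus d1); first exact/torus_tuple4.
exact/(tnth_tuple4 (fun z => `|z| = 1)).
Qed.

Lemma K_S_P d w : (1 < d)%N -> K_ d (S_P R) w <->
  exists a a' b b', [/\ a * a' = 1, b * b' = 1, `|a| = 1, `|b| = 1
    & w = from_torus [tuple a; a'; b; b']].
Proof.
have inv1 (x y : C) : x * y = 1 -> `|x| = 1 -> `|y| = 1.
  by move=> xy x1; rewrite -[LHS]mul1r -x1 -normrM xy normr1.
move=> d1; split.
  move=> [/S_P_torus[a [a' [b [b' [ha hb ->]]]]]].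
  have tt : torus [tuple a; a'; b; b'].
    by apply/torus_tuple4; rewrite ha mul1r hb.
  move/(bounded_orbit_torus d1 tt)/(tnth_tuple4 (fun z => `|z| = 1)).
  by move=> [? _ ? _]; exists a, a', b, b'.
move=> [a [a' [b [b' [ha hb na nb ->]]]]]; split.
  by apply/S_P_torus; exists a, a', b, b'.
apply/(bounded_orbit_torus d1); first by apply/torus_tuple4; rewrite ha mul1r hb.
apply/(tnth_tuple4 (fun z => `|z| = 1)); split => //; [exact: inv1 ha na|exact: inv1 hb nb].
Qed.

Lemma K_S_A_G_A d w : (1 < d)%N -> K_ d (S_A R) w <->
  exists u v : R, [/\ -2 <= u <= 2, -2 <= v <= 2 & w = G_A u%:C%C v%:C%C].
Proof.
move=> d1; rewrite K_S_A //; split.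
  move=> [a [b [c [h na nb nc ->]]]].
  have [||u u2 eu] := @unit_trace _ (a * a) (b * c);
    [by rewrite -h; ring|by rewrite normrM na mulr1|].
  have [||v v2 ev] := @unit_trace _ (a * b) (a * c);
    [by rewrite -h; ring|by rewrite normrM na nb mulr1|].
  by exists u, v; rewrite from_torus_G_A // eu ev.
move=> [u [v [/unit_trace_onto[x [x' [xx' nx _ <-]]]
  /unit_trace_onto[y [y' [yy' ny ny' <-]]] ->]]].
(* The pairs (x, x') and (y, y') have to become (a^2, b c) and (a b, a c), so a is a square root of
   x, b = y / a and c = y' / a. *)
have := sqrtCK x; set a := sqrtC x => aa.
have na : `|a| = 1.
  apply/eqP; rewrite -(@eqrXn2 _ 2) // expr1n -normrX aa nx //.
have a0 : a != 0 by rewrite -normr_eq0 na oner_eq0.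
have ab : a * (y / a) = y by rewrite mulrC divfK.
have ac : a * (y' / a) = y' by rewrite mulrC divfK.
have bc : y / a * (y' / a) = x'.
  apply: (mulfI (expf_neq0 2 a0)); rewrite {2}aa xx' -yy'.
  by rewrite expr2 mulrACA ab ac.
have h : a * a * (y / a) * (y' / a) = 1.
  by rewrite -mulrA bc -expr2 aa.
exists a, (y / a), (y' / a); split => //.
- by rewrite normf_div ny na divr1.
- by rewrite normf_div ny' na divr1.
- by rewrite from_torus_G_A // ab ac bc -expr2 aa.
Qed.

Lemma K_S_P_H_P d w : (1 < d)%N -> K_ d (S_P R) w <->
  exists u v : R, [/\ -2 <= u <= 2, -2 <= v <= 2 & w = H_P u%:C%C v%:C%C].
Proof.
move=> d1; rewrite K_S_P //; split.
  move=> [a [a' [b [b' [ha hb na nb ->]]]]].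
  have [u u2 eu] := unit_trace ha na; have [v v2 ev] := unit_trace hb nb.
  by exists u, v; rewrite from_torus_H_P // eu ev.
move=> [u [v [/unit_trace_onto[x [x' [xx' nx _ <-]]]
  /unit_trace_onto[y [y' [yy' ny _ <-]]] ->]]].
by exists x, x', y, y'; rewrite from_torus_H_P.
Qed.

Lemma G_A_realpt (b : R * R) : G_A b.1%:C%C b.2%:C%C = realpt (GA b).
Proof.
rewrite /G_A /realpt /GA; congr (_, _, _, _);
  by rewrite !(rmorphD, rmorphM, rmorphXn, fmorphV, rmorph_nat).
Qed.

Lemma H_P_realpt (b : R * R) : H_P b.1%:C%C b.2%:C%C = realpt (GP b).
Proof.
rewrite /H_P /realpt /GP; congr (_, _, _, _);
  by rewrite !(rmorphD, rmorphM, rmorphXn, fmorphV, rmorph_nat).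
Qed.

Lemma K_S_A_face d : (1 < d)%N -> K_ d (S_A R) = snd @` @faceA R.
Proof.
move=> d1; apply/seteqP; split => w; rewrite K_S_A_G_A //.
  move=> [u [v [/andP[u1 u2] /andP[v1 v2] ->]]].
  exists ((u, v), realpt (GA (u, v))); last exact: (esym (G_A_realpt (u, v))).
  by apply/faceAP; split => //; apply/squareP.
move=> [[[u v] y] /faceAP[/squareP/= [u1 u2 v1 v2] ->] /= <-].
exists u, v; rewrite u1 u2 v1 v2; split => //.
exact: (esym (G_A_realpt (u, v))).
Qed.

Lemma GP_wedge (b : R * R) : square b -> exists2 c, wedge c & GP c = GP b.
Proof.
case: b => c e /squareP/= [c1 c2 e1 e2].
have [h|h] := leP e c; have [h'|h'] := leP (- c) e.
- by exists (c, e) => //; apply/wedgeP.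
- exists (- e, - c); first by apply/wedgeP => /=; split; lra.
  by rewrite /GP /=; congr (_, _, _, _); ring.
- exists (e, c); first by apply/wedgeP => /=; split; lra.
  by rewrite /GP /=; congr (_, _, _, _); ring.
- exists (- c, - e); first by apply/wedgeP => /=; split; lra.
  by rewrite /GP /=; congr (_, _, _, _); ring.
Qed.

Lemma K_S_P_face d : (1 < d)%N -> K_ d (S_P R) = snd @` @faceP R.
Proof.
move=> d1; apply/seteqP; split => w; rewrite K_S_P_H_P //.
  move=> [u [v [/andP[u1 u2] /andP[v1 v2] ->]]].
  have [|c wc cE] := @GP_wedge (u, v); first exact/squareP.
  exists (wedge_pos c, realpt (GP c)); first by apply/facePP; exists c.
  by rewrite cE; exact: (esym (H_P_realpt (u, v))).
move=> [[b y] /facePP[c wc [_ ->]] /= <-].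
move/wedgeP: (wc) => [h1 h2 h3].
exists c.1, c.2; split; [apply/andP; split; lra|apply/andP; split; lra|].
exact: (esym (H_P_realpt c)).
Qed.

Lemma S_A_S_P : S_A R `&` S_P R = C_1 R `|` C_2 R.
Proof.
apply/seteqP; split => w.
  move=> [/S_A_torus[a [b [c [h ->]]]]]; rewrite from_torus_G_A //.
  move: (a * a + _) (a * b + _) => u v [/= e _].
  (* The product is p^2 - n^2 with n^2 = s. Its zeros v = 2, -2 give points of [C_2], and u = 2, -2
     give points of [C_1]. *)
  have : (2 - v) ^+ 2 * (1 - u / 2) * ((2 + v) ^+ 2 * (1 + u / 2)) = 0.
    by rewrite -e; field.
  move/eqP; rewrite mulf_eq0 => /orP[]; rewrite mulf_eq0 => /orP[];
    rewrite ?sqrf_eq0 => /eqP h'.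
  - have -> : v = 2 by move/eqP: h'; rewrite subr_eq0 => /eqP <-.
    by right; exists (u + 2) => //; rewrite /G_A; congr (_, _, _, _); field.
  - have -> : u = 2.
      have -> : u = 2 * (1 - (1 - u / 2)) by field.
      by rewrite h' subr0 mulr1.
    by left; exists (v + 2) => //; rewrite /G_A; congr (_, _, _, _); field.
  - have -> : v = - 2 by move/eqP: h'; rewrite addrC addr_eq0 => /eqP.
    by right; exists (2 - u) => //; rewrite /G_A; congr (_, _, _, _); field.
  - have -> : u = - 2.
      have -> : u = 2 * ((1 + u / 2) - 1) by field.
      by rewrite h' sub0r mulrN1.
    by left; exists (2 - v) => //; rewrite /G_A; congr (_, _, _, _); field.
move=> [[t _ <-]|[T _ <-]]; split; split; rewrite /A_h; ring.
Qed.

(** A double entry, inverse pairs and unit moduli all survive t -> t^e, for any exponent e. *)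
Lemma g_invariant d e : (1 < d)%N ->
  g_ e @` (K_ d (S_A R) `|` K_ d (S_P R)) `<=` K_ d (S_A R) `|` K_ d (S_P R).
Proof.
move=> d1 _ [w [] + <-].
  move/(K_S_A _ d1) => [a [b [c [h na nb nc ->]]]]; left; apply/(K_S_A _ d1).
  rewrite g_from_torus ?tpow_tuple4; last exact/torus_tuple4.
  exists (a ^+ e), (b ^+ e), (c ^+ e).
  by rewrite !normrX na nb nc -!exprMn h !expr1n.
move/(K_S_P _ d1) => [a [a' [b [b' [ha hb na nb ->]]]]]; right; apply/(K_S_P _ d1).
rewrite g_from_torus ?tpow_tuple4; last by apply/torus_tuple4; rewrite ha mul1r.
exists (a ^+ e), (a' ^+ e), (b ^+ e), (b' ^+ e).
by rewrite !normrX na nb -!exprMn ha hb !expr1n.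
Qed.

Lemma g1_id w : X_Q R w -> g_ 1 w = w.
Proof.
move=> /from_torus_onto[t tt <-]; rewrite g_from_torus //; congr from_torus.
by apply: eq_from_tnth => i; rewrite tnth_mktuple expr1.
Qed.

Lemma G_A_angles (u v : R) : -2 <= u <= 2 -> -2 <= v <= 2 ->
  exists alpha beta, [/\ 0 <= alpha < 2 * pi, 0 <= beta < 2 * pi,
    u = 2 * cos (2 * alpha) & v = 2 * cos (alpha + beta)].
Proof.
move=> /andP[u1 u2] /andP[v1 v2].
have pi0 := pi_gt0 R.
have hu : -1 <= u / 2 <= 1 by apply/andP; split; lra.
have hv : -1 <= v / 2 <= 1 by apply/andP; split; lra.
have cu : cos (acos (u / 2)) = u / 2 by apply: acosK; rewrite in_itv.
have cv : cos (acos (v / 2)) = v / 2 by apply: acosK; rewrite in_itv.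
have := acos_ge0 hu; have := acos_lepi hu; have := acos_ge0 hv; have := acos_lepi hv.
move: (acos (u / 2)) (acos (v / 2)) cu cv => x y cx cy y1 y0 x1 x0.
(* The angles solve 2 alpha = x and alpha + beta = y; a negative beta is shifted by a full turn. *)
pose b : R := if x / 2 <= y then y - x / 2 else y - x / 2 + 2 * pi.
exists (x / 2), b; split.
- by apply/andP; split; lra.
- rewrite /b; have [h|h] := leP (x / 2) y; apply/andP; split; lra.
- have -> : 2 * (x / 2) = x by field.
  by rewrite cx; field.
- have -> : cos (x / 2 + b) = cos y.
    rewrite /b; case: leP => _; first by congr cos; ring.
    have -> : x / 2 + (y - x / 2 + 2 * pi) = y + pi *+ 2.
      by rewrite -mulr_natl; ring.
    exact: cosD2pi.
  by rewrite cy; field.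
Qed.

End JuliaSets.

Theorem proposition4p23 (R : realType) :
  (* (1) *)
  (forall d : nat, (1 < d)%N ->
     K_ d (S_A R) =
     [set w | exists alpha beta : R,
        [/\ 0 <= alpha < 2 * pi, 0 <= beta < 2 * pi
          & w = G_A (2 * cos (2 * alpha))%:C%C
                    (2 * cos (alpha + beta))%:C%C]]) /\
  (* (2) *)
  S_A R `&` S_P R = C_1 R `|` C_2 R /\
  (* (3) *)
  (forall d : nat, (1 < d)%N ->
     K_ d (S_A R) `&` K_ d (S_P R) = K_ d (C_1 R) `|` K_ d (C_2 R)) /\
  (* (4) *)
  (forall d : nat, (1 < d)%N ->
     @real_surface R (C4top R) (K_ d (S_A R) `|` K_ d (S_P R))) /\
  (forall d : nat, (0 < d)%N ->
     g_ d @` (K_ d (S_A R) `|` K_ d (S_P R))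
       `<=` K_ d (S_A R) `|` K_ d (S_P R)) /\
  (forall d e : nat, (1 < d)%N -> (0 < e)%N ->
     g_ e @` (K_ d (S_A R) `|` K_ d (S_P R))
       `<=` K_ d (S_A R) `|` K_ d (S_P R)).
Proof.
split; [|split; [|split; [|split; [|split]]]].
- move=> d d1; apply/seteqP; split => w; rewrite K_S_A_G_A //.
    move=> [u [v [/G_A_angles hu /hu[alpha [beta [a2 b2 -> ->]]] ->]]].
    by exists alpha, beta.
  move=> [alpha [beta [_ _ ->]]].
  exists (2 * cos (2 * alpha)), (2 * cos (alpha + beta)).
  have c2 (x : R) : -2 <= 2 * cos x <= 2.
    by have := cos_geN1 x; have := cos_le1 x => ? ?; apply/andP; split; lra.
  by rewrite !c2.
- exact: S_A_S_P.
(* Boundedness of an orbit does not refer to the subvariety, so the claim follows from (2). *)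
- move=> d _; have := S_A_S_P R => E.
  apply/seteqP; split => w.
    move=> [[wA bw] [wP _]]; have : (C_1 R `|` C_2 R) w by rewrite -E.
    by case=> ?; [left|right].
  have h : (C_1 R `|` C_2 R) w -> S_A R w /\ S_P R w by rewrite -E.
  move=> [[wC bw]|[wC bw]].
    by have [wA wP] := h (or_introl wC); split; split.
  by have [wA wP] := h (or_intror wC); split; split.
- by move=> d d1; rewrite K_S_A_face // K_S_P_face //; exact: faces_surface.
(* The description by unit entries covers d >= 2 only; for d = 1 the map is the identity on
   [X_Q]. *)
- move=> [|[|d]] // _; last exact: g_invariant.
  have XQ w : (K_ 1 (S_A R) `|` K_ 1 (S_P R)) w -> X_Q R w.
    by case: w => [[[p q] r] s] [[[_ h] _]|[[_ h] _]] /=;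
      apply/eqP; rewrite -oppr_eq0 opprB; apply/eqP.
  by move=> _ [w wK <-]; rewrite g1_id //; exact: XQ.
- by move=> d e d1 _; exact: g_invariant.
Qed.
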